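(* Let $P\subseteq\mathbb{R}^d$ be a $d$-dimensional polytope given by a simplex-containing non-degenerate system $Ax\le b$ of $m$ linear inequalities ($A\in\mathbb{R}^{m\times d}$, $b\in\mathbb{R}^m$), i.e. $P=\{x\in\mathbb{R}^d\mid Ax\le b\}$. Then for every $\epsilon>0$ and every point $o\in\mathbb{R}^d$ with $B^d_\epsilon(o)\subseteq P$ there exists a simple rock extension $Q$ of $P$ (with respect to the system $Ax\le b$) that is $\epsilon$-concentrated around $(o,1)$ and such that for each vertex of $Q$ there exists a $z$-increasing path of length at most $m-d$ in the graph of $Q$ from that vertex to the top vertex $(o,1)$.
   Context: For a row vector $\alpha\neq 0$ and $\beta\in\mathbb{R}$ let $H^{=}(\alpha,\beta)=\{x\in\mathbb{R}^d\mid\alpha x=\beta\}$. $A_i$ denotes the $i$-th row of $A$, and $A_I$, $b_I$ denote the rows of $A$ resp. entries of $b$ indexed by $I\subseteq[m]=\{1,\dots,m\}$. The hyperplane arrangement $\mathcal{H}(A,b)$ of $Ax\le b$ is the family $H^{=}(A_1,b_1),\dots,H^{=}(A_m,b_m)$; a vertex of $\mathcal{H}(A,b)$ is a point that is the intersection of some of these hyperplanes (equivalently, a feasible or infeasible basic solution of $Ax\le b$). Non-degenerate system: a feasible system $Ax\le b$ such that each vertex of $\mathcal{H}(A,b)$ is contained in exactly $d$ of the $m$ hyperplanes. A non-degenerate system is simplex-containing if there is $I\subseteq[m]$ with $|I|=d+1$ such that $\{x\in\mathbb{R}^d\mid A_Ix\le b_I\}$ is a $d$-simplex. Rock extension: for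 a polytope $P=\{x\mid Ax\le b\}$, any polytope of the form $Q=\{(x,z)\in\mathbb{R}^{d+1}\mid Ax+az\le b,\ z\ge 0\}$ with $a\in\mathbb{R}^m_{>0}$. The base of $Q$ is the facet $P\times\{0\}$ of $Q$ defined by $z\ge0$; vertices of $Q$ in the base are base vertices, all others are non-base vertices. A top vertex of $Q$ is a vertex with maximal $z$-coordinate. $B^k_\epsilon(q)$ is the open Euclidean ball in $\mathbb{R}^k$ of radius $\epsilon$ with center $q$. For $\epsilon>0$, a rock extension $Q$ of $P$ is $\epsilon$-concentrated around $(o,h)\in\mathbb{R}^d\times\mathbb{R}_{>0}$ if $(o,h)$ is the unique top vertex of $Q$, $B^d_\epsilon(o)\subseteq P$, and all non-base vertices of $Q$ lie in $B^{d+1}_\epsilon((o,h))$. A $q$-dimensional polytope is simple if each of its vertices is contained in exactly $q$ facets. The graph of a polytope consists of its vertices and edges (one-dimensional faces). The length of a path is its number of edges; a path is $z$-increasing if the sequence of $z$-coordinates of the vertices along the path is strictly increasing. *)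

(* Defs.v *)
From mathcomp Require Import all_boot all_order all_algebra.
From mathcomp Require Import all_classical all_reals all_analysis.

Set Implicit Arguments.
Unset Strict Implicit.
Unset Printing Implicit Defensive.

Import Order.TTheory GRing.Theory Num.Theory.
Import numFieldNormedType.Exports.

Local Open Scope classical_set_scope.
Local Open Scope ring_scope.

(* Points of R^n are column vectors 'cV[R]_n. *)

(* The norm that the library puts on matrices is the sup norm, so the Euclidean
   ball is spelled out. *)
Definition eball (R : realType) (k : nat) (e : R) (q : 'cV[R]_k) :
    set 'cV[R]_k :=
  [set x | Num.sqrt (\sum_(i < k) (x i 0 - q i 0) ^+ 2) < e].

Definition polyhedron (R : realType) (m n : nat)
    (A : 'M[R]_(m, n)) (b : 'cV[R]_m) : set 'cV[R]_n :=
  [set x | forall i : 'I_m, (A *m x) i 0 <= b i 0].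

Definition polytope (R : realType) (n : nat) (S : set 'cV[R]_n) : Prop :=
  (exists (m : nat) (A : 'M[R]_(m, n)) (b : 'cV[R]_m), S = polyhedron A b)
  /\ bounded_set S.

Definition aff_indep (R : realType) (n k : nat) (p : 'I_k -> 'cV[R]_n) : Prop :=
  forall c : 'I_k -> R,
    \sum_i c i = 0 -> \sum_i c i *: p i = 0 -> forall i, c i = 0.

(* The affine hull of S has dimension k; this never holds for S empty. *)
Definition has_dim (R : realType) (n : nat) (S : set 'cV[R]_n) (k : nat) : Prop :=
  (exists p : 'I_k.+1 -> 'cV[R]_n, (forall i, S (p i)) /\ aff_indep p)
  /\ (forall p : 'I_k.+2 -> 'cV[R]_n, (forall i, S (p i)) -> ~ aff_indep p).

Definition conv_hull (R : realType) (n k : nat) (p : 'I_k -> 'cV[R]_n) :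
    set 'cV[R]_n :=
  [set x | exists t : 'I_k -> R,
     [/\ forall i, 0 <= t i, \sum_i t i = 1 & x = \sum_i t i *: p i]].

Definition is_simplex (R : realType) (n k : nat) (S : set 'cV[R]_n) : Prop :=
  exists p : 'I_k.+1 -> 'cV[R]_n, aff_indep p /\ S = conv_hull p.

(* Taking c = 0 shows that S itself and the empty set are faces of S. *)
Definition face (R : realType) (n : nat) (S F : set 'cV[R]_n) : Prop :=
  exists (c : 'rV[R]_n) (delta : R),
    (forall x, S x -> (c *m x) 0 0 <= delta)
    /\ F = S `&` [set x | (c *m x) 0 0 = delta].

Definition vertex (R : realType) (n : nat) (S : set 'cV[R]_n) (v : 'cV[R]_n) : Prop :=
  face S [set v].

Definition facet (R : realType) (n : nat) (S F : set 'cV[R]_n) : Prop :=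
  face S F /\ exists k : nat, has_dim S k.+1 /\ has_dim F k.

(* u and v are the two end points of an edge (one-dimensional face) of S. *)
Definition adjacent_vertices (R : realType) (n : nat) (S : set 'cV[R]_n) (u v : 'cV[R]_n) : Prop :=
  [/\ vertex S u, vertex S v, u <> v &
      exists F : set 'cV[R]_n, [/\ face S F, has_dim F 1, F u & F v]].

Definition simple_polytope (R : realType) (n q : nat) (S : set 'cV[R]_n) : Prop :=
  [/\ polytope S, has_dim S q &
      forall v, vertex S v -> ([set F | facet S F /\ F v] #= `I_q)%card].

(* The hyperplanes are indexed by the rows of A, so repeated hyperplanes are
   counted with multiplicity. *)
Definition arrangement_vertex (R : realType) (m d : nat)
    (A : 'M[R]_(m, d)) (b : 'cV[R]_m) (x : 'cV[R]_d) : Prop :=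
  exists I : {set 'I_m},
    [set y : 'cV[R]_d | forall i, i \in I -> (A *m y) i 0 = b i 0] = [set x].

(* A row of A must be nonzero for its equation to define a hyperplane. *)
Definition nondegenerate_system (R : realType) (m d : nat)
    (A : 'M[R]_(m, d)) (b : 'cV[R]_m) : Prop :=
  [/\ forall i, row i A != 0,
      polyhedron A b !=set0 &
      forall x, arrangement_vertex A b x ->
        #|[set i : 'I_m | (A *m x) i 0 == b i 0]%SET| = d].

Definition simplex_containing (R : realType) (m d : nat)
    (A : 'M[R]_(m, d)) (b : 'cV[R]_m) : Prop :=
  exists I : {set 'I_m}, #|I| = d.+1 /\
    is_simplex d [set x : 'cV[R]_d | forall i, i \in I -> (A *m x) i 0 <= b i 0].

(* The point (x, z) of R^(d+1). *)
Definition pt (R : realType) (d : nat) (x : 'cV[R]_d) (z : R) : 'cV[R]_(d + 1) :=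
  col_mx x z%:M.

Definition zcoord (R : realType) (d : nat) (w : 'cV[R]_(d + 1)) : R :=
  w (rshift d 0) 0.

Definition rock_extension (R : realType) (m d : nat)
    (A : 'M[R]_(m, d)) (b : 'cV[R]_m) (Q : set 'cV[R]_(d + 1)) : Prop :=
  polytope Q /\
  exists a : 'cV[R]_m, (forall i, 0 < a i 0) /\
    Q = [set w | exists (x : 'cV[R]_d) (z : R),
           [/\ w = pt x z,
               forall i, (A *m x + z *: a) i 0 <= b i 0 & 0 <= z]].

Definition rock_base (R : realType) (d : nat) (P : set 'cV[R]_d) : set 'cV[R]_(d + 1) :=
  [set pt x 0 | x in P].

Definition top_vertex (R : realType) (d : nat) (Q : set 'cV[R]_(d + 1))
    (v : 'cV[R]_(d + 1)) : Prop :=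
  vertex Q v /\ forall w, vertex Q w -> zcoord w <= zcoord v.

Definition concentrated (R : realType) (d : nat) (P : set 'cV[R]_d)
    (Q : set 'cV[R]_(d + 1)) (eps : R) (o : 'cV[R]_d) (h : R) : Prop :=
  [/\ forall v, top_vertex Q v <-> v = pt o h,
      eball eps o `<=` P &
      forall v, vertex Q v -> ~ rock_base P v -> eball eps (pt o h) v].

(* v :: p is a z-increasing path in the graph of Q from v to w; its number of
   edges is size p. *)
Definition z_increasing_path (R : realType) (d : nat) (Q : set 'cV[R]_(d + 1))
    (v w : 'cV[R]_(d + 1)) (p : seq 'cV[R]_(d + 1)) : Prop :=
  [/\ path (fun x y => `[< adjacent_vertices Q x y >]) v p,
      path (fun x y => zcoord x < zcoord y) v p &
      last v p = w].

(* Main.v *)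
(* The extension is built by adding the inequalities one at a time, starting from
   the d + 1 ones that bound a simplex: there the pyramid with apex (o, 1) works.
   When A_k x <= b_k is added, its hyperplane is tilted so that it passes just above
   the apex.  If the previous extension is concentrated closely enough around the
   apex, no non-base vertex is cut off, so old z-increasing paths survive.  A new
   non-base vertex lies on the unique non-base edge of a removed base vertex and
   inherits the rest of that vertex's path without extra edge; a new base vertex
   reaches such a vertex by one edge inside the new hyperplane, so the length bound
   grows by one.  Vertices, edges and facets are read off the sets of tight
   inequalities, all of size d + 1 at a vertex. *)
Require Import Defs.
From mathcomp Require Import all_boot all_order all_algebra.
From mathcomp Require Import all_classical all_reals all_analysis.
From mathcomp Require Import zify ring lra.

Set Implicit Arguments.
Unset Strict Implicit.
Unset Printing Implicit Defensive.

Import Order.TTheory GRing.Theory Num.Theory.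
Import numFieldNormedType.Exports.

Local Open Scope classical_set_scope.
Local Open Scope ring_scope.

(** * Linear forms and inequality systems *)

Section LinearForms.
Variables (R : realType) (n : nat).
Implicit Types (f g : 'rV[R]_n) (x y w : 'cV[R]_n).

(** The radius has to be quantified inside the induction: to reach radius [e] for the larger system,
    the smaller one needs a radius [e'] that depends on how far the base vertices cut off by row [k]
    lie beyond its hyperplane. These vertices belong to the arrangement of [A] and [b] alone, so
    [a k] and [e'] can be fixed before the other tilts are known. The starting simplex has a second
    use: a positive dependency [lam] among its normals keeps every intermediate system bounded and
    every height at most 1. The bound [m - d] is the length 1 of a climb in the pyramid plus one for
    each of the remaining [m - d - 1] inequalities. *)

Definition ev f w : R := (f *m w) 0 0.

Lemma evDr f x y : ev f (x + y) = ev f x + ev f y.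
Proof. by rewrite /ev mulmxDr mxE. Qed.

Lemma evZr f t x : ev f (t *: x) = t * ev f x.
Proof. by rewrite /ev -scalemxAr mxE. Qed.

Lemma evNr f x : ev f (- x) = - ev f x.
Proof. by rewrite /ev mulmxN mxE. Qed.

Lemma evBr f x y : ev f (x - y) = ev f x - ev f y.
Proof. by rewrite evDr evNr. Qed.

Lemma ev0r f : ev f 0 = 0.
Proof. by rewrite /ev mulmx0 mxE. Qed.

Lemma ev0l x : ev 0 x = 0.
Proof. by rewrite /ev mul0mx mxE. Qed.

Lemma ev_sumr (J : finType) (Q : pred J) f (F : J -> 'cV[R]_n) :
  ev f (\sum_(j | Q j) F j) = \sum_(j | Q j) ev f (F j).
Proof. by rewrite /ev mulmx_sumr summxE. Qed.

Lemma ev_suml (J : finType) (Q : pred J) (F : J -> 'rV[R]_n) x :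
  ev (\sum_(j | Q j) F j) x = \sum_(j | Q j) ev (F j) x.
Proof. by rewrite /ev mulmx_suml summxE. Qed.

Lemma evZl t f x : ev (t *: f) x = t * ev f x.
Proof. by rewrite /ev -scalemxAl mxE. Qed.

Lemma evE f x : ev f x = \sum_j f 0 j * x j 0.
Proof. by rewrite /ev mxE. Qed.

(** It dominates the Euclidean norm and bounds linear forms directly, so the estimates of the
    construction use it in place of [eball]. *)
Definition l1norm x : R := \sum_j `|x j 0|.

Lemma l1norm_ge0 x : 0 <= l1norm x.
Proof. by apply: sumr_ge0. Qed.

Lemma l1normD x y : l1norm (x + y) <= l1norm x + l1norm y.
Proof.
rewrite -big_split /=; apply: ler_sum => j _; rewrite mxE; exact: ler_normD.
Qed.

Lemma l1normZ t x : l1norm (t *: x) = `|t| * l1norm x.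
Proof. by rewrite /l1norm mulr_sumr; apply: eq_bigr => j _; rewrite mxE normrM. Qed.

Lemma l1norm0 : l1norm 0 = 0.
Proof. by rewrite /l1norm big1// => j _; rewrite mxE normr0. Qed.

Lemma l1norm_sum (J : finType) (F : J -> 'cV[R]_n) :
  l1norm (\sum_j F j) <= \sum_j l1norm (F j).
Proof.
elim/big_ind2: _ => [|x1 y1 x2 y2 h1 h2|//]; first by rewrite l1norm0.
by apply: le_trans (l1normD _ _) _; rewrite lerD.
Qed.

Lemma l1norm_coord x j : `|x j 0| <= l1norm x.
Proof. by rewrite /l1norm (bigD1 j)//= lerDl sumr_ge0. Qed.

Lemma l1norm_eq0 x : l1norm x = 0 -> x = 0.
Proof.
move=> x0; apply/matrixP => j k; rewrite ord1 mxE; apply/eqP.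
by rewrite -normr_le0 -x0 l1norm_coord.
Qed.

Lemma ev_bound f x : `|ev f x| <= (\sum_j `|f 0 j|) * l1norm x.
Proof.
rewrite evE mulr_suml; apply: le_trans (ler_norm_sum _ _ _) _.
by apply: ler_sum => j _; rewrite normrM ler_wpM2l// l1norm_coord.
Qed.

(** Each square is at most its absolute value times [l1norm], so the Euclidean norm is at most the
    l1 norm. *)
Lemma eball_l1norm (e : R) x w : l1norm (w - x) < e -> eball e x w.
Proof.
apply: le_lt_trans.
rewrite -[leRHS]ger0_norm ?l1norm_ge0// -sqrtr_sqr; apply: ler_wsqrtr.
rewrite expr2 {1}/l1norm mulr_suml; apply: ler_sum => j _.
have -> : (w j 0 - x j 0) ^+ 2 = `|(w - x) j 0| * `|(w - x) j 0|.
  by rewrite !mxE -normrM ger0_norm ?expr2 ?sqr_ge0// -expr2 sqr_ge0.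
by rewrite ler_wpM2l// l1norm_coord.
Qed.

End LinearForms.

Lemma common_lower_bound (R : realType) (J : finType) (Q : J -> Prop) (F : J -> R) :
  (forall j, Q j -> 0 < F j) -> exists2 t, 0 < t & forall j, Q j -> t <= F j.
Proof.
move=> Fpos; pose F' j := if `[< Q j >] then F j else 1.
have F'pos j : 0 < F' j by rewrite /F'; case: asboolP => // /Fpos.
exists (\big[Num.min/1]_j F' j) => [|j Qj].
  by elim/big_ind: _ => // x y x0 y0; rewrite lt_min x0 y0.
by have -> : F j = F' j by [rewrite /F' asboolT]; exact: bigmin_le.
Qed.

(** * Feasible points, tight sets and basic points of an inequality system *)

Section Systems.
Variables (R : realType) (n : nat) (I : finType).
Variables (r : I -> 'rV[R]_n) (c : I -> R).
Implicit Types (S T : {set I}) (w v g h : 'cV[R]_n) (i k : I).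

Definition feasible S : set 'cV[R]_n :=
  [set w | forall i, i \in S -> ev (r i) w <= c i].

Definition tight S w : {set I} := [set i in S | ev (r i) w == c i]%SET.

(** The rows in [T] span the dual space, expressed as triviality of their common kernel. *)
Definition spanning T : Prop :=
  forall g, (forall i, i \in T -> ev (r i) g = 0) -> g = 0.

Definition basic S w : Prop := feasible S w /\ spanning (tight S w).

(** Algebraic form of the two ends of an edge. *)
Definition neighbours S v w : Prop :=
  [/\ basic S v, basic S w & #|tight S v :&: tight S w|.+1 = n].

Lemma tightP S w i : reflect (i \in S /\ ev (r i) w = c i) (i \in tight S w).
Proof. by rewrite inE; apply: (iffP andP) => -[iS /eqP ?]; split=> //; apply/eqP. Qed.

Definition row_matrix T : 'M[R]_(#|T|, n) := \matrix_(j < #|T|) r (enum_val j).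

Lemma row_matrix_mul T g : (row_matrix T *m g = 0) <-> (forall i, i \in T -> ev (r i) g = 0).
Proof.
have rE (j : 'I_#|T|) : (row_matrix T *m g) j 0 = ev (r (enum_val j)) g.
  by rewrite /ev !mxE; apply: eq_bigr => l _; rewrite !mxE.
split=> [g0 i iT|g0].
  by rewrite -(enum_rankK_in iT iT) -rE g0 mxE.
apply/matrixP => j l; rewrite (ord1 l) rE mxE; apply: g0; exact: enum_valP.
Qed.

Lemma spanning_rank T : spanning T -> \rank (row_matrix T) = n.
Proof.
move=> spT; rewrite -mxrank_tr; apply/eqP; rewrite -/(row_free _).
apply: inj_row_free => u uT; apply: trmx_inj; rewrite trmx0; apply: spT.
by apply/row_matrix_mul; apply: trmx_inj; rewrite trmx_mul trmxK trmx0.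
Qed.

Lemma spanning_card T : spanning T -> (n <= #|T|)%N.
Proof. by move=> /spanning_rank {1}<-; exact: rank_leq_row. Qed.

Lemma not_spanning T : ~ spanning T ->
  exists2 g, g != 0 & forall i, i \in T -> ev (r i) g = 0.
Proof.
move=> nsp; apply: contrapT => nex; apply: nsp => g gT.
by apply: contrapT => /eqP g0; apply: nex; exists g.
Qed.

(** The rows in [T] form an invertible square matrix; the columns of its inverse are the [D j]. *)
Lemma dual_basis T : spanning T -> #|T| = n ->
  exists D : I -> 'cV[R]_n,
    forall i j, i \in T -> j \in T -> ev (r i) (D j) = (i == j)%:R.
Proof.
move=> spT cT; have fr : row_free (row_matrix T) by rewrite /row_free spanning_rank// cT.
(* [enum_rank_in] needs an element of [T], so dimension 0 is treated separately. *)
case: (posnP #|T|) => [T0|T0].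
  exists (fun=> 0) => i j; move/eqP: T0; rewrite cards_eq0 => /eqP ->; by rewrite inE.
have [i0 i0T] : exists i, i \in T by apply/finset.set0Pn; rewrite -cards_eq0 -lt0n.
exists (fun j => col (enum_rank_in i0T j) (pinvmx (row_matrix T))) => i j iT jT.
have := mulmxVp fr => /matrixP/(_ (enum_rank_in i0T i) (enum_rank_in i0T j)).
rewrite [RHS]mxE (inj_in_eq (can_in_inj (enum_rankK_in i0T)))// => <-.
by rewrite /ev !mxE; apply: eq_bigr => l _; rewrite !mxE enum_rankK_in.
Qed.

Lemma dual_expand T (D : I -> 'cV[R]_n) : spanning T ->
    (forall i j, i \in T -> j \in T -> ev (r i) (D j) = (i == j)%:R) ->
  forall w, w = \sum_(j in T) ev (r j) w *: D j.
Proof.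
move=> spT rD w; apply/eqP; rewrite -subr_eq0; apply/eqP/spT => i iT.
rewrite evBr ev_sumr (bigD1 i)//= evZr rD// eqxx mulr1 big1 ?addr0 ?subrr// => j.
by move=> /andP[jT ji]; rewrite evZr rD// eq_sym (negPf ji) mulr0.
Qed.

(** The ratio test of the simplex method: only inequalities that increase along [g] can block, and
    the one with the smallest ratio of slack to slope becomes tight first. *)
Lemma ray_shoot S w g i0 : feasible S w -> i0 \in S -> 0 < ev (r i0) g ->
  exists t k, [/\ 0 <= t, feasible S (w + t *: g), k \in tight S (w + t *: g) &
    k \in S /\ 0 < ev (r k) g].
Proof.
move=> fw i0S gi0; pose Q := [pred i in S | 0 < ev (r i) g].
pose F i := (c i - ev (r i) w) / ev (r i) g.
have Qi0 : Q i0 by rewrite /Q /= i0S.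
case: (arg_minP F Qi0) => k /andP[/= kS gk] mink.
have Fk : 0 <= F k by rewrite divr_ge0 ?subr_ge0 ?fw// ltW.
exists (F k), k; split => //.
  move=> i iS; rewrite evDr evZr; case: (ltP 0 (ev (r i) g)) => gi.
    by have := mink i; rewrite /= iS gi => /(_ isT); rewrite {2}/F ler_pdivlMr// lerBrDl.
  have := fw i iS; rewrite -(lerD2r (F k * ev (r i) g)) => /le_trans; apply.
  by rewrite gerDl mulr_ge0_le0.
apply/tightP; split=> //; rewrite evDr evZr /F divfK ?gt_eqF//; ring.
Qed.

(** Inequalities that are not tight have positive slack, which leaves room for a step; the summand 1
    in the denominators avoids division by zero. *)
Lemma small_step S v g : feasible S v ->
    (forall i, i \in tight S v -> ev (r i) g <= 0) ->
  exists2 t, 0 < t & feasible S (v + t *: g).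
Proof.
move=> fv gT.
have [t t0 tF] : exists2 t, 0 < t & forall i, i \in S :\: tight S v ->
    t <= (c i - ev (r i) v) / (1 + `|ev (r i) g|).
  apply: common_lower_bound => i; rewrite !inE => /andP[nt iS].
  rewrite divr_gt0 ?subr_gt0 ?ltr_pwDl// lt_neqAle fv// andbT.
  by move: nt; rewrite iS.
exists t => // i iS; rewrite evDr evZr.
case: (boolP (i \in tight S v)) => [it|nt].
  have := fv i iS; have := gT i it => gle fle.
  by apply: le_trans fle; rewrite gerDl mulr_ge0_le0// ltW.
have /tF : i \in S :\: tight S v by rewrite inE nt.
rewrite ler_pdivlMr ?ltr_pwDl// => tle; rewrite -lerBrDl; apply: le_trans tle.
rewrite ler_wpM2l ?ltW//; have := ler_norm (ev (r i) g); lra.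
Qed.

(* On the kernel of T, which is at most a line, r k is injective. *)
Lemma kernel_line T k g h : spanning (k |: T) ->
    (forall i, i \in T -> ev (r i) g = 0) -> (forall i, i \in T -> ev (r i) h = 0) ->
    ev (r k) g != 0 ->
  h = (ev (r k) h / ev (r k) g) *: g.
Proof.
move=> sp gT hT gk; apply/eqP; rewrite -subr_eq0; apply/eqP/sp => i.
rewrite !inE => /orP[/eqP ->|iT].
  by rewrite evBr evZr divfK ?subrr.
by rewrite evBr evZr (gT i)// (hT i)// mulr0 subrr.
Qed.

Lemma tightU1 S k w : ev (r k) w = c k -> tight (k |: S) w = k |: tight S w.
Proof.
by move=> kw; apply/finset.setP => i; rewrite !inE andb_orl; case: eqVneq => // ->; rewrite kw eqxx.
Qed.

Lemma tightU1_neq S k w : ev (r k) w != c k -> tight (k |: S) w = tight S w.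
Proof.
move=> kw; apply/finset.setP => i; rewrite !inE andb_orl.
by case: (eqVneq i k) => // ->; rewrite (negPf kw) !andbF.
Qed.

Lemma feasibleU1 S k w : feasible (k |: S) w <-> ev (r k) w <= c k /\ feasible S w.
Proof.
split=> [fw|[kw fw] i].
  by split=> [|i iS]; apply: fw; rewrite !inE ?eqxx ?iS ?orbT.
by rewrite !inE => /orP[/eqP ->|/fw].
Qed.

(* Sliding along the line fixed by T until a new inequality becomes tight. *)
Lemma ray_to_basic S T w k g i0 : feasible S w -> T \subset tight S w ->
    spanning (k |: T) -> (forall i, i \in T -> ev (r i) g = 0) -> ev (r k) g != 0 ->
    i0 \in S -> 0 < ev (r i0) g ->
  exists t, [/\ 0 <= t, basic S (w + t *: g) & T \subset tight S (w + t *: g)]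
     /\ exists2 j, j \in tight S (w + t *: g) & 0 < ev (r j) g.
Proof.
move=> fw /fintype.subsetP Tw sp gT gk i0S gi0.
have [t [j [t0 ft jt [jS gj]]]] := ray_shoot fw i0S gi0.
have Tt : T \subset tight S (w + t *: g).
  apply/fintype.subsetP => i iT; have /tightP[iS iw] := Tw i iT.
  by apply/tightP; rewrite evDr evZr gT// mulr0 addr0.
exists t; split; last by exists j.
split=> //; split=> // h ht.
have hT i : i \in T -> ev (r i) h = 0 by move=> iT; apply: ht; exact: (fintype.subsetP Tt).
(* [h] is a multiple of [g], and [j], tight at the end point and increasing along [g], forces the
   factor to be 0. *)
have hE := kernel_line sp gT hT gk.
have := ht j jt; rewrite hE evZr => /eqP; rewrite mulf_eq0 (gt_eqF gj) orbF => /eqP ->.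
by rewrite scale0r.
Qed.

End Systems.

(** * Faces of a simple inequality system *)

Section AffineDimension.
Variables (R : realType) (n : nat) (I : finType) (r : I -> 'rV[R]_n).
Implicit Types (F : set 'cV[R]_n) (J : {set I}).

(** Row [j] separates [q j] from [v] but no other [q i] with index in [J], so applying it to a
    dependency isolates one coefficient. *)
Lemma aff_indep_fan F v J (q : I -> 'cV[R]_n) : F v -> (forall j, j \in J -> F (q j)) ->
    (forall i j, i \in J -> j \in J -> (ev (r i) (q j - v) != 0) = (i == j)) ->
  exists p : 'I_#|J|.+1 -> 'cV[R]_n, (forall i, F (p i)) /\ aff_indep p.
Proof.
move=> Fv Fq rq.
exists (fun i => if unlift ord0 i is Some j then q (enum_val j) else v).
split=> [i|e e0 ep]; first by case: unliftP => [j|] _ //; apply: Fq; exact: enum_valP.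
have eS (j : 'I_#|J|) : e (lift ord0 j) = 0.
  have : \sum_i e i *: ((if unlift ord0 i is Some j then q (enum_val j) else v) - v) = 0.
    under eq_bigr do rewrite scalerBr.
    by rewrite sumrB ep -scaler_suml e0 scale0r subrr.
  move=> /(congr1 (ev (r (enum_val j)))); rewrite ev0r ev_sumr (bigD1 (lift ord0 j))//= liftK.
  rewrite big1 => [|i ij].
    rewrite addr0 evZr => /eqP; rewrite mulf_eq0.
    have -> : (ev (r (enum_val j)) (q (enum_val j) - v) == 0) = false.
      by apply/negbTE; rewrite rq ?enum_valP// eqxx.
    by rewrite orbF => /eqP.
  case: unliftP ij => [l ->|->] ij; last by rewrite subrr scaler0 ev0r.
  rewrite evZr; have -> : ev (r (enum_val j)) (q (enum_val l) - v) = 0; last by rewrite mulr0.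
  apply/eqP/negbNE; rewrite rq ?enum_valP//; apply: contra ij => /eqP/enum_val_inj ->.
  exact: eqxx.
move=> i; case: (unliftP ord0 i) => [j ->|->]; first exact: eS.
by move: e0; rewrite big_ord_recl big1 ?addr0// => j _; exact: eS.
Qed.

(** The [k] differences of the points are independent and annihilated by the rows in [J], which are
    independent because of their dual vectors [D]. *)
Lemma aff_indep_bound k (p : 'I_k.+1 -> 'cV[R]_n) J (D : I -> 'cV[R]_n) (c : I -> R) :
    aff_indep p ->
    (forall i j, i \in J -> j \in J -> ev (r i) (D j) = (i == j)%:R) ->
    (forall i l, i \in J -> ev (r i) (p l) = c i) ->
  (k + #|J| <= n)%N.
Proof.
move=> pfree rD rp.
pose X : 'M[R]_(k, n) := \matrix_i (p (lift ord0 i) - p ord0)^T.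
have Xfree : row_free X.
  apply: inj_row_free => u uX.
  (* A linear dependency of the differences becomes an affine one when the base point takes minus
     the sum of the coefficients. *)
  pose e (i : 'I_k.+1) := if unlift ord0 i is Some j then u 0 j else - \sum_j u 0 j.
  have e0 : e ord0 = - \sum_j u 0 j by rewrite /e unlift_none.
  have eS j : e (lift ord0 j) = u 0 j by rewrite /e liftK.
  apply/matrixP => l j; rewrite (ord1 l) mxE -eS; apply: pfree.
    by rewrite big_ord_recl e0; under [X in _ + X]eq_bigr do rewrite eS; rewrite addNr.
  rewrite big_ord_recl e0; under [X in _ + X]eq_bigr do rewrite eS.
  apply: trmx_inj; rewrite trmx0 -uX mulmx_sum_row linearD linear_sum /=.
  under [in RHS]eq_bigr do rewrite rowK linearB /= scalerBr.
  rewrite sumrB -scaler_suml addrC linearZ /= sumrN scaleNr; congr (_ - _).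
  by rewrite linear_sum; apply: eq_bigr => i _; rewrite linearZ.
have Jfree : row_free (row_matrix r J).
  apply/row_freeP; exists (\matrix_(a, j) D (enum_val j) a 0).
  apply/matrixP => i j; rewrite !mxE -(inj_eq enum_val_inj) -rD ?enum_valP//.
  by rewrite evE; apply: eq_bigr => a _; rewrite !mxE.
have : X *m (row_matrix r J)^T = 0.
  apply/row_matrixP => i; rewrite row0 row_mul rowK -trmx_mul.
  have -> : row_matrix r J *m (p (lift ord0 i) - p ord0) = 0; last by rewrite trmx0.
  by apply/row_matrix_mul => j jJ; rewrite evBr !rp// subrr.
by move/mulmx0_rank_max; rewrite mxrank_tr (eqP Xfree) (eqP Jfree).
Qed.

Lemma aff_indep_sub k l (p : 'I_k -> 'cV[R]_n) (lk : (l <= k)%N) :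
  aff_indep p -> aff_indep (p \o widen_ord lk).
Proof.
move=> pfree e e0 ep i.
pose e' (j : 'I_k) := if insub (val j) is Some j' then e j' else 0.
have e'E j : e' (widen_ord lk j) = e j.
  by rewrite /e' /=; case: insubP => [j' _ /val_inj ->|]; rewrite ?ltn_ord.
rewrite -e'E; apply: pfree.
  rewrite (bigID (fun j : 'I_k => (j < l)%N))/= [X in _ + X]big1 ?addr0; last first.
    by move=> j jl; rewrite /e' insubN.
  by rewrite (big_ord_narrow lk (F := e')) -[RHS]e0; apply: eq_bigr => j _; exact: e'E.
rewrite (bigID (fun j : 'I_k => (j < l)%N))/= [X in _ + X]big1 ?addr0; last first.
  by move=> j jl; rewrite /e' insubN// scale0r.
rewrite (big_ord_narrow lk (F := fun j => e' j *: p j)) -[RHS]ep.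
by apply: eq_bigr => j _; rewrite e'E.
Qed.

Lemma has_dim_le F k l : has_dim F k -> has_dim F l -> (k <= l)%N.
Proof.
move=> [[p [Fp pfree]] _] [_ nl]; rewrite leqNgt; apply/negP => lk.
by apply: (nl (p \o widen_ord (lk : (l.+2 <= k.+1)%N))) => [i|]; [exact: Fp|exact: aff_indep_sub].
Qed.

Lemma has_dim_inj F k l : has_dim F k -> has_dim F l -> k = l.
Proof. by move=> Fk Fl; apply/eqP; rewrite eqn_leq !(@has_dim_le F). Qed.

End AffineDimension.

(** * Vertices, edges and facets in terms of tight sets *)

Section Faces.
Variables (R : realType) (n : nat) (I : finType).
Variables (r : I -> 'rV[R]_n) (c : I -> R).
Implicit Types (v w u g h : 'cV[R]_n) (i j : I) (T J : {set I}).

Let Q : set 'cV[R]_n := feasible r c [set: I].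
Let tgt w := tight r c [set: I] w.

Definition subface J : set 'cV[R]_n :=
  Q `&` [set w | forall i, i \in J -> ev (r i) w = c i].

(** The sum of the rows in [J] is a supporting form: slacks are nonnegative, so the sum is tight
    only where every summand is. *)
Lemma face_subface J : face Q (subface J).
Proof.
exists (\sum_(j in J) r j), (\sum_(j in J) c j); split=> [w Qw|].
  by rewrite -/(ev _ _) ev_suml; apply: ler_sum => j _; exact: Qw.
rewrite /subface; apply/seteqP; split=> w [Qw /= Jw]; split=> //=.
  by rewrite -/(ev _ _) ev_suml; apply: eq_bigr => j jJ; rewrite Jw.
have := Jw; rewrite -/(ev _ _) ev_suml => /eqP; rewrite eq_sym -subr_eq0 -sumrB => /eqP s0 i iJ.
apply/eqP; rewrite eq_sym -subr_eq0; apply/eqP; move: i iJ.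
by apply: (psumr_eq0P _ s0) => i _; rewrite subr_ge0; exact: Qw.
Qed.

(** A direction that fixes all tight inequalities can be followed both ways, so the supporting form
    is constant along it and the one-point face forces it to be zero. Conversely, the tight
    inequalities of a basic point cut out that point. *)
Lemma vertex_basic v : vertex Q v <-> basic r c [set: I] v.
Proof.
split=> [[f [e [fle fE]]]|[Qv sp]].
  have [Qv fv] : (Q `&` [set x | (f *m x) 0 0 = e]) v by rewrite -fE.
  split=> // g g0.
  have up h (hT : forall i, i \in tgt v -> ev (r i) h = 0) : ev f h <= 0.
    have [|t t0 ft] := small_step (g := h) Qv; first by move=> i /hT ->.
    have := fle _ ft; rewrite -/(ev _ _) evDr evZr -fv -/(ev _ _) gerDl.
    by rewrite pmulr_rle0.
  have fg : ev f g = 0.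
    apply/le_anti; rewrite up//= -oppr_le0 -evNr up// => i iT.
    by rewrite evNr g0 ?oppr0.
  have [|t t0 ft] := small_step (g := g) Qv; first by move=> i /g0 ->.
  have : [set v] (v + t *: g).
    by rewrite fE; split=> //=; rewrite -/(ev _ _) evDr evZr fg mulr0 addr0.
  move=> /= /eqP; rewrite -subr_eq0 addrC addrA addNr add0r scaler_eq0 (gt_eqF t0) /=.
  by move/eqP.
rewrite /vertex; have -> : [set v] = subface (tgt v); last exact: face_subface.
apply/seteqP; split=> [_ ->|w [Qw wT] /=].
  by split=> // i /tightP[].
apply/eqP; rewrite -subr_eq0; apply/eqP/sp => i iT.
by rewrite evBr wT//; case/tightP: iT => _ ->; rewrite subrr.
Qed.

(* Moving along minus the dual basis relaxes one tight inequality at a time. *)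
Lemma fan_at_basic v : basic r c [set: I] v -> #|tgt v| = n ->
  exists D q : I -> 'cV[R]_n,
    [/\ forall i j, i \in tgt v -> j \in tgt v -> ev (r i) (D j) = (i == j)%:R,
        forall i, i \in tgt v -> Q (q i),
        forall i j, i \in tgt v -> j \in tgt v -> (ev (r i) (q j - v) != 0) = (i == j) &
        forall f i, i \in tgt v -> exists2 t, 0 < t & ev f (q i) = ev f v - t * ev f (D i)].
Proof.
move=> [Qv sp] cT; have [D rD] := dual_basis sp cT.
have step j : exists t, j \in tgt v -> 0 < t /\ Q (v + t *: - D j).
  case: (boolP (j \in tgt v)) => jT; last by exists 0.
  have [|t t0 ft] := small_step (g := - D j) Qv; last by exists t.
  by move=> i iT; rewrite evNr rD// oppr_le0.
have [t tP] := choice step.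
exists D, (fun j => v + t j *: - D j); split=> // [i /tP[]//|i j iT jT|f i iT].
  have [tj _] := tP j jT; rewrite addrC addrA addNr add0r evZr evNr rD//.
  by rewrite mulf_eq0 (gt_eqF tj) oppr_eq0 pnatr_eq0 eqb0 negbK.
by exists (t i); [case: (tP i iT)|rewrite evDr evZr evNr mulrN].
Qed.

(** Each tight inequality outside [J] contributes one point of the fan, and the rows in [J] bound
    the dimension from above. *)
Lemma has_dim_subface v J : basic r c [set: I] v -> #|tgt v| = n -> J \subset tgt v ->
  has_dim (subface J) (n - #|J|).
Proof.
move=> bv cT JT; have [D [q [rD Qq rq qE]]] := fan_at_basic bv cT.
have JT' := fintype.subsetP JT.
split=> [|p Fp pfree].
  have -> : (n - #|J| = #|tgt v :\: J|)%N by rewrite cardsD (finset.setIidPr JT) cT.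
  apply: (@aff_indep_fan _ _ _ r _ v _ q) => [|j|i j].
  - by split; [case: bv|move=> i /JT' /tightP[]].
  - rewrite inE => /andP[jJ jT]; split; first exact: Qq.
    move=> i iJ; have iT := JT' i iJ; have [_ <-] := tightP _ _ _ _ _ iT.
    apply/eqP; rewrite -subr_eq0 -evBr; apply: contraNT jJ; rewrite rq// => /eqP <-.
    exact: iJ.
  - by rewrite !finset.in_setD => /andP[_ iT] /andP[_ jT]; exact: rq.
have := @aff_indep_bound _ _ _ r _ p J D c pfree.
have rDJ i j : i \in J -> j \in J -> ev (r i) (D j) = (i == j)%:R.
  by move=> /JT' iT /JT' jT; exact: rD.
have rpJ i l : i \in J -> ev (r i) (p l) = c i by move=> iJ; case: (Fp l) => _; apply.
move=> /(_ rDJ rpJ); have : (#|J| <= n)%N by rewrite -cT subset_leq_card.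
lia.
Qed.

Lemma has_dim_feasible v : basic r c [set: I] v -> #|tgt v| = n -> has_dim Q n.
Proof.
move=> bv cT; have := has_dim_subface bv cT (finset.sub0set _).
rewrite cards0 subn0; congr has_dim.
by rewrite /subface; apply/seteqP; split=> [w []//|w Qw]; split=> // i; rewrite inE.
Qed.

Lemma neighbours_adjacent u v : #|tgt u| = n -> u <> v ->
  neighbours r c [set: I] u v -> adjacent_vertices Q u v.
Proof.
move=> cu uv [bu bv cI]; split; [exact/vertex_basic|exact/vertex_basic|by []|].
exists (subface (tgt u :&: tgt v)); split; first exact: face_subface.
- have := has_dim_subface bu cu (finset.subsetIl _ (tgt v)); congr has_dim.
  by move: cI; rewrite -/(tgt u) -/(tgt v); lia.
- by split; [case: bu|move=> i; rewrite inE => /andP[/tightP[]]].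
- by split; [case: bv|move=> i; rewrite inE => /andP[_ /tightP[]]].
Qed.

Lemma facet_subface v i : basic r c [set: I] v -> #|tgt v| = n -> i \in tgt v ->
  facet Q (subface [set i]).
Proof.
move=> bv cT iT; split; first exact: face_subface.
have n0 : (0 < n)%N by rewrite -cT; apply/card_gt0P; exists i.
exists n.-1; split; first by rewrite prednK//; exact: (has_dim_feasible bv cT).
by have := has_dim_subface bv cT (J := [set i]); rewrite cards1 subn1 finset.sub1set; apply.
Qed.

(** In the dual basis the slack of the supporting form is a nonnegative combination of the slacks of
    the inequalities tight at [v]. The face is cut out by those with nonzero coefficient, and its
    dimension leaves exactly one. *)
Lemma facet_at_basic v F : basic r c [set: I] v -> #|tgt v| = n -> facet Q F -> F v ->
  exists2 i, i \in tgt v & F = subface [set i].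
Proof.
move=> bv cT [[f [e [fle ->]]] [k [Qk Fk]]] [Qv /= fv].
have [D [q [rD Qq rq qE]]] := fan_at_basic bv cT.
have kn : k.+1 = n := has_dim_inj Qk (has_dim_feasible bv cT).
set F' := Q `&` _ in Fk *.
have rv i : i \in tgt v -> ev (r i) v = c i by move/tightP => [].
have fD i : i \in tgt v -> 0 <= ev f (D i).
  move=> iT; have [t t0 tE] := qE f i iT.
  have := fle _ (Qq i iT); rewrite -/(ev _ _) tE -fv -/(ev _ _) gerBl.
  by rewrite pmulr_rge0.
have fE w : e - ev f w = \sum_(i in tgt v) (c i - ev (r i) w) * ev f (D i).
  rewrite -fv -/(ev f v) -evBr (dual_expand bv.2 rD (v - w)) ev_sumr.
  by apply: eq_bigr => i iT; rewrite evZr evBr rv.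
pose J := [set i in tgt v | ev f (D i) != 0]%SET.
have JT : J \subset tgt v by apply/fintype.subsetP => i; rewrite inE => /andP[].
have FE : F' = subface J.
  apply/seteqP; split=> w [Qw /= wE]; split=> //=.
    move=> i; rewrite inE => /andP[iT fi].
    have := fE w; rewrite {1}/ev wE subrr => /esym s0.
    have : (c i - ev (r i) w) * ev f (D i) = 0.
      move: (i) (iT); apply: (psumr_eq0P _ s0) => j jT.
      by rewrite mulr_ge0 ?fD// subr_ge0; exact: Qw.
    by move/eqP; rewrite mulf_eq0 (negPf fi) orbF subr_eq0 => /eqP.
  apply/eqP; rewrite -/(ev f w) eq_sym -subr_eq0 fE big1// => i iT.
  case: (eqVneq (ev f (D i)) 0) => [->|fi]; first by rewrite mulr0.
  by rewrite wE ?subrr ?mul0r// inE iT.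
have : #|J| = 1%N.
  have := has_dim_inj Fk; rewrite FE => /(_ _ (has_dim_subface bv cT JT)).
  have : (#|J| <= n)%N by rewrite -cT subset_leq_card.
  lia.
move/eqP/cards1P => [i Ji]; exists i; last by rewrite FE Ji.
by apply: (fintype.subsetP JT); rewrite Ji finset.set11.
Qed.

Lemma card_set_finset (T : finType) (U : {set T}) : ([set` U] #= `I_#|U|)%card.
Proof.
have -> : [set` U] = range (@enum_val _ (mem U)).
  apply/seteqP; split=> [i /= iU|_ [j _ <-]]; last exact: enum_valP.
  by exists (enum_rank_in iU i) => //; rewrite enum_rankK_in.
apply: (@card_eq_trans _ _ _ _ [set: 'I_#|U|]); last by rewrite card_eq_sym card_II.
by apply: inj_card_eq => i j _ _; exact: enum_val_inj.
Qed.

Lemma card_facets v : basic r c [set: I] v -> #|tgt v| = n ->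
  ([set F | facet Q F /\ F v] #= `I_n)%card.
Proof.
move=> bv cT.
have -> : [set F | facet Q F /\ F v] = (fun i => subface [set i]) @` [set` tgt v].
  apply/seteqP; split=> [F [Ff Fv]|_ [i iT <-]].
    by have [i iT ->] := facet_at_basic bv cT Ff Fv; exists i.
  split; first exact: facet_subface bv cT iT.
  by split; [case: bv|move=> j; rewrite inE => /eqP ->; have [_ ->] := tightP _ _ _ _ _ iT].
rewrite -[in `I_n]cT.
apply: card_eq_trans (card_set_finset (tgt v)); apply: inj_card_eq => i j.
move=> /set_mem iT /set_mem jT ij.
have [D [q [rD Qq rq qE]]] := fan_at_basic bv cT.
(* Distinct tight inequalities give distinct facets: [q j] lies on every hyperplane tight at [v]
   except that of [j]. *)
apply/eqP; apply: contrapT => /negP nij.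
have : subface [set i] (q j).
  split; first exact: Qq.
  move=> l; rewrite inE => /eqP ->; have [_ <-] := tightP _ _ _ _ _ iT.
  by apply/eqP; rewrite -subr_eq0 -evBr; apply: contraNT nij; rewrite rq.
rewrite ij => -[_ /(_ j)]; rewrite inE eqxx => /(_ isT) qj.
have := rq j j jT jT; rewrite evBr qj eqxx.
by have [_ ->] := tightP _ _ _ _ _ jT; rewrite subrr eqxx.
Qed.

End Faces.

(** * The inductive construction *)

Lemma card_setD1_succ (T : finType) (X : {set T}) x n :
  x \in X -> #|X| = (n + 1)%N -> #|X :\ x| = n.
Proof. by move=> xX; rewrite (cardsD1 x) xX addn1 add1n => -[]. Qed.

Section Points.
Variables (R : realType) (d : nat).
Implicit Types (x y : 'cV[R]_d) (z s t : R) (w v : 'cV[R]_(d + 1)).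

Lemma zcoord_pt x z : zcoord (pt x z) = z.
Proof. by rewrite /zcoord /pt col_mxEd mxE eqxx mulr1n. Qed.

Lemma zcoordD v w : zcoord (v + w) = zcoord v + zcoord w.
Proof. by rewrite /zcoord mxE. Qed.

Lemma zcoordZ t w : zcoord (t *: w) = t * zcoord w.
Proof. by rewrite /zcoord mxE. Qed.

Lemma pt_eta w : w = pt (usubmx w) (zcoord w).
Proof.
rewrite /pt -[LHS]vsubmxK; congr col_mx; apply/matrixP => i j.
by rewrite !ord1 !mxE eqxx mulr1n.
Qed.

Lemma pt_inj x y z s : pt x z = pt y s -> x = y /\ z = s.
Proof.
move=> e; split; last by rewrite -(zcoord_pt x z) e zcoord_pt.
by have := congr1 usubmx e; rewrite /pt !col_mxKu.
Qed.

Lemma ptB x y z s : pt x z - pt y s = pt (x - y) (z - s).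
Proof. by rewrite /pt opp_col_mx add_col_mx -raddfB. Qed.

Lemma pt0 : pt 0 0 = 0 :> 'cV[R]_(d + 1).
Proof. by rewrite /pt raddf0 col_mx0. Qed.

Lemma ev_pt (f : 'rV[R]_d) s x z : ev (row_mx f s%:M) (pt x z) = ev f x + s * z.
Proof. by rewrite /ev /pt mul_row_col mxE -scalar_mxM [X in _ + X]mxE eqxx mulr1n. Qed.

Lemma l1norm_pt x z : l1norm (pt x z) = l1norm x + `|z|.
Proof.
rewrite /l1norm /pt big_split_ord /= big_ord1 col_mxEd mxE eqxx mulr1n; congr (_ + _).
by apply: eq_bigr => i _; rewrite col_mxEu.
Qed.

End Points.

(** * Inequality systems of rock extensions *)

Section RockSystem.
Variables (R : realType) (m d : nat) (A : 'M[R]_(m, d)) (b : 'cV[R]_m).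
Implicit Types (a : 'I_m -> R) (S T : {set 'I_m}) (x y : 'cV[R]_d) (w v u : 'cV[R]_(d + 1)).

Definition arow (i : 'I_m) : 'rV[R]_d := row i A.
Definition arhs (i : 'I_m) : R := b i 0.

Lemma ev_arow i x : ev (arow i) x = (A *m x) i 0.
Proof. by rewrite /ev /arow -row_mul mxE. Qed.

(* None stands for the base inequality -z <= 0. *)
Definition rrow a (j : option 'I_m) : 'rV[R]_(d + 1) :=
  if j is Some i then row_mx (arow i) (a i)%:M else row_mx 0 (-1)%:M.
Definition rrhs (j : option 'I_m) : R := if j is Some i then arhs i else 0.
Definition ract S : {set option 'I_m} := None |: [set Some i | i in S]%SET.

Lemma None_ract S : None \in ract S.
Proof. by rewrite !inE. Qed.

Lemma Some_ract S i : (Some i \in ract S) = (i \in S).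
Proof. by rewrite finset.in_setU1 /= mem_imset// => ? ? []. Qed.

Lemma card_ract S : #|ract S| = #|S|.+1.
Proof.
rewrite cardsU1 card_imset => [|? ? []//].
by have -> : None \notin [set Some i | i in S]%SET by apply/negP => /imsetP[].
Qed.

Lemma ract_setT : ract [set: 'I_m]%SET = [set: option 'I_m]%SET.
Proof. by apply/finset.setP => -[i|]; rewrite ?Some_ract ?None_ract !inE. Qed.

Lemma ractU1 k S : ract (k |: S) = Some k |: ract S.
Proof.
apply/finset.setP => -[i|]; last by rewrite None_ract finset.in_setU1 None_ract orbT.
by rewrite Some_ract [RHS]finset.in_setU1 Some_ract finset.in_setU1.
Qed.

Lemma ev_None a w : ev (rrow a None) w = - zcoord w.
Proof. by rewrite (pt_eta w) ev_pt ev0l zcoord_pt add0r mulN1r. Qed.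

Lemma ev_Some a i x z : ev (rrow a (Some i)) (pt x z) = ev (arow i) x + a i * z.
Proof. exact: ev_pt. Qed.

(** Nondegeneracy stated for all subsystems at once, at infeasible points too. *)
Definition nondegenerate : Prop := forall S x,
  spanning arow (tight arow arhs S x) ->
  #|tight arow arhs S x| = d /\
  forall k, ev (arow k) x = arhs k -> k \in tight arow arhs S x.

(** A spanning tight set has at least [d] elements and sits among the [d] hyperplanes through the
    point, so it is all of them. *)
Lemma nondegenerate_systemP : nondegenerate_system A b -> nondegenerate.
Proof.
move=> [_ _ nd] S x sp.
have /nd cx : arrangement_vertex A b x.
  exists (tight arow arhs S x); apply/seteqP; split=> [y /= yT|_ -> i /tightP[_]].
    apply/eqP; rewrite -subr_eq0; apply/eqP/sp => i iT; rewrite evBr.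
    by have [_ ->] := tightP _ _ _ _ _ iT; rewrite ev_arow yT// subrr.
  by rewrite ev_arow.
set X := [set i | _]%SET in cx.
have TX : tight arow arhs S x \subset X.
  by apply/fintype.subsetP => i /tightP[_]; rewrite ev_arow inE => ->.
have TE : tight arow arhs S x = X.
  by apply/eqP; rewrite eqEcard TX cx /=; apply: spanning_card sp.
rewrite TE; split=> [//|k]; rewrite inE ev_arow => ->; exact: eqxx.
Qed.

Section Base.
Variable a : 'I_m -> R.
Let rbasic S := basic (rrow a) rrhs (ract S).
Let rtight S := tight (rrow a) rrhs (ract S).

Lemma tight_base S x : rtight S (pt x 0) = ract (tight arow arhs S x).
Proof.
apply/finset.setP => -[i|].
  rewrite Some_ract; apply/tightP/tightP; rewrite Some_ract ev_Some mulr0 addr0 //.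
by rewrite None_ract; apply/tightP; rewrite None_ract ev_None zcoord_pt oppr0.
Qed.

Lemma spanning_base S x :
  spanning (rrow a) (rtight S (pt x 0)) -> spanning arow (tight arow arhs S x).
Proof.
move=> sp g gT; suff: pt g 0 = pt 0 0 by case/pt_inj.
rewrite pt0; apply: sp => -[i|]; rewrite tight_base.
  by rewrite Some_ract ev_Some mulr0 addr0 => /gT.
by rewrite ev_None zcoord_pt oppr0.
Qed.

(** A base vertex lies over a vertex of the arrangement of [A] and [b], so its count does not depend
    on the tilts; [None] accounts for the extra 1. *)
Lemma card_tight_base S x : nondegenerate -> rbasic S (pt x 0) ->
  #|rtight S (pt x 0)| = (d + 1)%N.
Proof. by move=> nd [_ /spanning_base /nd[cx _]]; rewrite tight_base card_ract cx addn1. Qed.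

Lemma feasible_z S w : feasible (rrow a) rrhs (ract S) w -> 0 <= zcoord w.
Proof. by move=> /(_ _ (None_ract S)); rewrite ev_None oppr_le0. Qed.

Lemma None_tight S w : (None \in rtight S w) = (zcoord w == 0).
Proof. by rewrite !inE ev_None oppr_eq0. Qed.

Definition climb S v w : Prop :=
  neighbours (rrow a) rrhs (ract S) v w /\ zcoord v < zcoord w.

End Base.

Variables (o : 'cV[R]_d) (I0 : {set 'I_m}).
Hypothesis nd : nondegenerate.
Hypothesis o_int : forall i, ev (arow i) o < arhs i.
(** The positive dependency among the outer normals of the starting simplex, supplied by
    [simplex_dependency]. *)
Variable lam : 'I_m -> R.
Hypothesis lam_gt0 : forall i, i \in I0 -> 0 < lam i.
Hypothesis lam_dep : \sum_(i in I0) lam i *: arow i = 0.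
Hypothesis I0_spanning : spanning arow I0.
Hypothesis I0_card : #|I0| = d.+1.

Let apex := pt o 1.

Lemma lam_ev x : \sum_(i in I0) lam i * ev (arow i) x = 0.
Proof.
rewrite -[RHS](ev0l x) -lam_dep ev_suml.
by apply: eq_bigr => i _; rewrite evZl.
Qed.

Lemma lam_mean_gt0 (F : 'I_m -> R) :
  (forall i, i \in I0 -> 0 < F i) -> 0 < \sum_(i in I0) lam i * F i.
Proof.
move=> F0; have [i iI] : exists i, i \in I0 by apply/finset.set0Pn; rewrite -cards_eq0 I0_card.
rewrite (bigD1 i)//= ltr_wpDr ?mulr_gt0 ?lam_gt0 ?F0//.
by apply: sumr_ge0 => j /andP[jI _]; rewrite mulr_ge0// ltW ?lam_gt0 ?F0.
Qed.

(** This makes every ray of the construction end. Weighted by [lam], the parts in [x] cancel and a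
    positive multiple of [zcoord g] remains, which forces height 0; then all terms of a zero sum of
    one sign vanish and [I0_spanning] applies. *)
Lemma recession_trivial S a g : I0 \subset S -> (forall i, i \in I0 -> 0 < a i) ->
  g != 0 -> exists2 j, j \in ract S & 0 < ev (rrow a j) g.
Proof.
move=> IS a0 g0; apply: contrapT => nex.
have gle j : j \in ract S -> ev (rrow a j) g <= 0.
  by move=> jS; rewrite leNgt; apply/negP => jg; apply: nex; exists j.
move/negP: g0; apply.
have z0 : 0 <= zcoord g by have := gle _ (None_ract S); rewrite ev_None oppr_le0.
have gle' i : i \in I0 -> ev (arow i) (usubmx g) + a i * zcoord g <= 0.
  by move=> iI; rewrite -ev_Some -pt_eta gle// Some_ract (fintype.subsetP IS).
have sumle : \sum_(i in I0) lam i * (ev (arow i) (usubmx g) + a i * zcoord g)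
    = (\sum_(i in I0) lam i * a i) * zcoord g.
  under eq_bigr do rewrite mulrDr mulrA.
  by rewrite big_split /= lam_ev add0r mulr_suml.
have gz : zcoord g = 0.
  apply/le_anti; rewrite z0 andbT -(pmulr_rle0 _ (lam_mean_gt0 a0)) -sumle.
  by apply: sumr_le0 => i iI; rewrite mulr_ge0_le0 ?gle'// ltW ?lam_gt0.
have : usubmx g = 0.
  apply: I0_spanning => i iI.
  have s0 := lam_ev (usubmx g).
  have s0' : \sum_(i in I0) lam i * - ev (arow i) (usubmx g) = 0.
    by under eq_bigr do rewrite mulrN; rewrite sumrN s0 oppr0.
  have /eqP : lam i * - ev (arow i) (usubmx g) = 0.
    move: (i) (iI); apply: (psumr_eq0P _ s0') => l lI; rewrite mulr_ge0//.
      by rewrite ltW ?lam_gt0.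
    by have := gle' l lI; rewrite gz mulr0 addr0 oppr_ge0.
  by rewrite mulf_eq0 gt_eqF ?lam_gt0//= oppr_eq0 => /eqP.
by move=> x0; rewrite (pt_eta g) gz x0 pt0.
Qed.

(** All rows in [I0] hold with equality at the apex, so the sum weighted by [lam] compares the
    heights of [w] and the apex. *)
Lemma feasible_z_le1 S a w : I0 \subset S ->
    (forall i, i \in I0 -> a i = arhs i - ev (arow i) o) ->
  feasible (rrow a) rrhs (ract S) w -> zcoord w <= 1.
Proof.
move=> IS aE fw; have a0 i : i \in I0 -> 0 < a i by move/aE ->; rewrite subr_gt0.
have le_sum : \sum_(i in I0) lam i * (ev (arow i) (usubmx w) + a i * zcoord w)
    <= \sum_(i in I0) lam i * (ev (arow i) o + a i * 1).
  apply: ler_sum => i iI; rewrite ler_wpM2l ?(ltW (lam_gt0 iI))//.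
  rewrite -ev_Some -pt_eta mulr1 aE// addrC subrK.
  by have := fw (Some i); rewrite Some_ract (fintype.subsetP IS)//; apply.
have sumE z x : \sum_(i in I0) lam i * (ev (arow i) x + a i * z)
    = (\sum_(i in I0) lam i * a i) * z.
  under eq_bigr do rewrite mulrDr mulrA.
  by rewrite big_split /= lam_ev add0r mulr_suml.
by move: le_sum; rewrite !sumE ler_pM2l// lam_mean_gt0.
Qed.

(** The induction invariant, in terms of tight sets instead of faces. The climb bound [#|S| - d]
    equals 1 on [I0]. *)
Definition rock_good S a (e : R) : Prop :=
  [/\ (forall i, i \in I0 -> a i = arhs i - ev (arow i) o) /\ (forall i, i \in S -> 0 < a i),
      basic (rrow a) rrhs (ract S) apex,
      forall v, basic (rrow a) rrhs (ract S) v ->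
        #|tight (rrow a) rrhs (ract S) v| = (d + 1)%N,
      forall v, basic (rrow a) rrhs (ract S) v -> 0 < zcoord v -> l1norm (v - apex) < e &
      forall v, basic (rrow a) rrhs (ract S) v ->
        exists2 p, path (fun v1 v2 => `[< climb a S v1 v2 >]) v p /\ last v p = apex
                 & (size p <= #|S| - d)%N].

(** Above the base only the [d + 1] rows of [I0] can be tight, and a basic point needs all of them.
    So the apex is the only non-base vertex, and every base vertex is joined to it. *)
Lemma rock_good_simplex a e : 0 < e ->
  (forall i, i \in I0 -> a i = arhs i - ev (arow i) o) -> rock_good I0 a e.
Proof.
move=> e0 aE; have a0 i : i \in I0 -> 0 < a i by move/aE ->; rewrite subr_gt0.
have tight_apex : tight (rrow a) rrhs (ract I0) apex = [set Some i | i in I0]%SET.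
  apply/finset.setP => -[i|].
    rewrite mem_imset => [|? ? []//]; apply/tightP/idP => [[]|iI].
      by rewrite Some_ract.
    by rewrite Some_ract; split=> //; rewrite ev_Some mulr1 aE//= addrC subrK.
  apply/idP/imsetP => [|[]//]; rewrite None_tight zcoord_pt; by rewrite oner_eq0.
have sp_apex : spanning (rrow a) [set Some i | i in I0]%SET.
  move=> g gI; apply: contrapT => /eqP g0.
  have gI' i : i \in I0 -> ev (rrow a (Some i)) g = 0 by move=> iI; apply: gI; exact: imset_f.
  (* Both [g] and [- g] must increase some inequality; the rows in [I0] vanish on [g], so both times
     it would be [None]. *)
  have [[i|]] := recession_trivial (fintype.subxx I0) a0 g0.
    by rewrite Some_ract => iI; rewrite gI' ?ltxx.
  move=> _; have gN0 : - g != 0 by rewrite oppr_eq0.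
  have [[i|]] := recession_trivial (fintype.subxx I0) a0 gN0.
    by rewrite Some_ract => iI; rewrite evNr gI' ?oppr0 ?ltxx.
  by rewrite evNr => _; lra.
have apex_feas : feasible (rrow a) rrhs (ract I0) apex.
  move=> [i|]; last by rewrite ev_None zcoord_pt /= oppr_le0.
  by rewrite Some_ract => iI; rewrite ev_Some aE// mulr1 addrC subrK.
have cI : #|[set Some i | i in I0]%SET| = (d + 1)%N.
  by rewrite card_imset ?I0_card ?addn1// => ? ? [].
have nonbase v : basic (rrow a) rrhs (ract I0) v -> 0 < zcoord v -> v = apex.
  move=> [fv sv] zv.
  have tv : tight (rrow a) rrhs (ract I0) v = [set Some i | i in I0]%SET.
    apply/eqP; rewrite eqEcard cI (spanning_card sv) andbT; apply/fintype.subsetP => -[i|].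
      by move=> /tightP[]; rewrite Some_ract => iI _; exact: imset_f.
    by rewrite None_tight gt_eqF.
  apply/eqP; rewrite -subr_eq0; apply/eqP/sp_apex => j jI; rewrite evBr.
  have := jI; rewrite -{1}tv => /tightP[_ ->].
  by move: jI; rewrite -tight_apex => /tightP[_ ->]; rewrite subrr.
have bapex : basic (rrow a) rrhs (ract I0) apex by split=> //; rewrite tight_apex.
have card_tight v : basic (rrow a) rrhs (ract I0) v ->
    #|tight (rrow a) rrhs (ract I0) v| = (d + 1)%N.
  move=> bv; case: (ltrgt0P (zcoord v)) => zv.
  - by rewrite (nonbase v)// tight_apex.
  - by have := feasible_z bv.1; rewrite leNgt zv.
  - by move: bv; rewrite (pt_eta v) zv; exact: card_tight_base.
split=> // [v bv zv|v bv]; first by rewrite (nonbase v)// subrr l1norm0.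
case: (ltrgt0P (zcoord v)) => zv.
- by exists [::] => //; split=> //=; exact: nonbase.
- by have := feasible_z bv.1; rewrite leNgt zv.
- exists [:: apex]; last by rewrite /= I0_card subSn// subnn.
  split=> //=; rewrite andbT; apply/asboolP; split; last by rewrite zv zcoord_pt.
  split=> //; rewrite tight_apex.
  (* The [d + 1] inequalities tight at a base vertex are [None] and [d] rows of [I0], and the latter
     are tight at the apex. *)
  have -> : tight (rrow a) rrhs (ract I0) v :&: [set Some i | i in I0]%SET
      = tight (rrow a) rrhs (ract I0) v :\ None.
    apply/finset.setP => -[i|]; rewrite finset.in_setI finset.in_setD1 /=.
      by rewrite mem_imset => [|? ? []//]; rewrite !inE /= mem_imset => [|? ? []//]; case: (i \in I0); rewrite ?andbF ?andbT.
    by rewrite andbC; apply/andP => -[/imsetP[]].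
  by have := cardsD1 None (tight (rrow a) rrhs (ract I0) v); rewrite card_tight// None_tight zv eqxx.
Qed.

(** A basic point is determined by its tight set, so only finitely many [x] occur and a minimum
    exists. The factor [1 + l1norm (x - o)] is the l1 distance from [pt x 0] to the apex. *)
Lemma cutoff_gap S k : exists2 g, 0 < g & forall x,
  spanning arow (tight arow arhs S x) -> arhs k < ev (arow k) x ->
  g * (1 + l1norm (x - o)) <= ev (arow k) x - arhs k.
Proof.
(* [T] indexes the points by a finite type; choice picks the point of each realized [T], and the
   value at other [T] is arbitrary. *)
pose cut T x := [/\ T = tight arow arhs S x, spanning arow T & arhs k < ev (arow k) x].
have pick T : exists y, (exists x, cut T x) -> cut T y.
  by case: (pselect (exists x, cut T x)) => [[x xT]|nx]; [exists x|exists 0 => /nx].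
have [f fP] := boolp.choice pick.
have norm_gt0 x : 0 < 1 + l1norm (x - o) by rewrite ltr_pwDl// l1norm_ge0.
have [|g g0 gF] := @common_lower_bound R _ (fun T => exists x, cut T x)
    (fun T => (ev (arow k) (f T) - arhs k) / (1 + l1norm (f T - o))).
  by move=> T /fP[_ _ lt]; rewrite divr_gt0 ?subr_gt0.
exists g => // x sp lt.
have ex : exists y, cut (tight arow arhs S x) y by exists x.
have [TE _ _] := fP _ ex; have := gF _ ex; rewrite ler_pdivlMr//.
suff -> : f (tight arow arhs S x) = x by [].
apply/eqP; rewrite -subr_eq0; apply/eqP/sp => i iT; rewrite evBr.
have := iT; rewrite {1}TE => /tightP[_ ->].
by have /tightP[_ ->] := iT; rewrite subrr.
Qed.

(* The tilt a k is taken just below the value for which the new hyperplane runs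
   through the apex: then it misses the e'-ball but crosses every segment from that
   ball to a cut-off base vertex within distance e of the apex. *)
Lemma tilt_exists S k e : 0 < e -> exists s e', let rk := row_mx (arow k) s%:M in
  [/\ 0 < s, 0 < e' /\ e' <= e,
      forall v, l1norm (v - apex) < e' -> ev rk v < arhs k &
      forall x v t, spanning arow (tight arow arhs S x) -> arhs k < ev (arow k) x ->
        l1norm (v - apex) < e' -> 0 <= t <= 1 ->
        ev rk ((1 - t) *: pt x 0 + t *: v) = arhs k ->
        l1norm ((1 - t) *: pt x 0 + t *: v - apex) < e].
Proof.
move=> e0; have [g g0 gP] := cutoff_gap S k.
have beta0 : 0 < arhs k - ev (arow k) o by rewrite subr_gt0.
(* The first bound keeps [s] positive; the second gives [2 * delta <= g * e / 2], as the last
   estimate requires. *)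
pose delta := Num.min ((arhs k - ev (arow k) o) / 2) (g * e / 4).
have delta0 : 0 < delta by rewrite lt_min !divr_gt0 ?mulr_gt0.
have delta1 : delta <= (arhs k - ev (arow k) o) / 2 by rewrite ge_min lexx.
have delta2 : delta <= g * e / 4 by rewrite ge_min lexx orbT.
pose s := arhs k - ev (arow k) o - delta.
pose rk : 'rV[R]_(d + 1) := row_mx (arow k) s%:M.
pose C := \sum_j `|rk 0 j|.
have C0 : 0 < 1 + C by rewrite ltr_pwDl// sumr_ge0.
(* Half of [e] is the share of [v] in the distance to the apex; the second bound keeps row [k]
   within [delta] of its apex value [arhs k - delta]. *)
exists s, (Num.min (e / 2) (delta / (1 + C))); rewrite -/rk /=.
have near v : l1norm (v - apex) < Num.min (e / 2) (delta / (1 + C)) ->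
    l1norm (v - apex) < e / 2 /\ `|ev rk v - (arhs k - delta)| < delta.
  rewrite lt_min => /andP[-> vC]; split=> //.
  have -> : ev rk v - (arhs k - delta) = ev rk (v - apex).
    by rewrite evBr [ev rk apex]ev_pt mulr1 /s; ring.
  apply: le_lt_trans (ev_bound _ _) _; rewrite -/C.
  move: vC; rewrite ltr_pdivlMr// mulrDr mulr1 mulrC.
  have := l1norm_ge0 (v - apex); lra.
split.
- rewrite /s; lra.
- by rewrite lt_min ge_min !divr_gt0//=; split=> //; apply/orP; left; lra.
- by move=> v /near[_]; rewrite ltr_norml => /andP[_]; lra.
move=> x v t sp lt /near[v1]; rewrite ltr_norml => /andP[v2 v3] /andP[t0 t1].
rewrite evDr !evZr [ev rk (pt x 0)]ev_pt mulr0 addr0 => rkE.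
have -> : (1 - t) *: pt x 0 + t *: v - apex = (1 - t) *: (pt x 0 - apex) + t *: (v - apex).
  by rewrite !scalerBr addrACA -opprD -scalerDl subrK scale1r.
apply: le_lt_trans (l1normD _ _) _; rewrite !l1normZ !ger0_norm ?subr_ge0//.
rewrite ptB sub0r l1norm_pt normrN normr1.
have gx := gP x sp lt.
(* The equation balances the excess at [x] against the slack at [v], which is below [2 * delta]; the
   gap [g] turns this into a distance. *)
have : (1 - t) * (l1norm (x - o) + 1) <= e / 2.
  rewrite -(ler_pM2l g0).
  have : (1 - t) * (g * (1 + l1norm (x - o))) <= (1 - t) * (ev (arow k) x - arhs k).
    by rewrite ler_wpM2l// subr_ge0.
  have : (1 - t) * (ev (arow k) x - arhs k) = t * (arhs k - ev rk v) by lra.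
  have : t * (arhs k - ev rk v) <= 1 * (arhs k - ev rk v) by rewrite ler_wpM2r//; lra.
  lra.
have : t * l1norm (v - apex) <= 1 * l1norm (v - apex) by rewrite ler_wpM2r// l1norm_ge0.
lra.
Qed.

(** * Adding one inequality *)

Section Step.
Variables (S : {set 'I_m}) (k : 'I_m) (a : 'I_m -> R) (e e' : R).
Hypotheses (IS : I0 \subset S) (kS : k \notin S) (ak_gt0 : 0 < a k) (ee' : e' <= e).
Let r := rrow a.
Let S' := k |: S.
Hypothesis miss : forall v, l1norm (v - apex) < e' -> ev (r (Some k)) v < arhs k.
Hypothesis near_apex : forall x v t,
  spanning arow (tight arow arhs S x) -> arhs k < ev (arow k) x ->
  l1norm (v - apex) < e' -> 0 <= t <= 1 ->
  ev (r (Some k)) ((1 - t) *: pt x 0 + t *: v) = arhs k ->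
  l1norm ((1 - t) *: pt x 0 + t *: v - apex) < e.
Hypothesis good : rock_good S a e'.

Let bas U := basic r rrhs (ract U).
Let tgt U := tight r rrhs (ract U).

Let aE : forall i, i \in I0 -> a i = arhs i - ev (arow i) o.
Proof. by case: good => -[]. Qed.
Let a_gt0 : forall i, i \in I0 -> 0 < a i.
Proof. by move=> i /aE ->; rewrite subr_gt0. Qed.
Let card_tgt : forall v, bas S v -> #|tgt S v| = (d + 1)%N.
Proof. by case: good. Qed.
Let IS' : I0 \subset S'.
Proof. by apply: fintype.subset_trans IS _; rewrite finset.subsetUr. Qed.

Lemma kept v : bas S v -> 0 < zcoord v -> ev (r (Some k)) v < arhs k.
Proof. by move=> bv zv; apply: miss; case: good => _ _ _ h _; exact: h. Qed.

Lemma tight_step v : ev (r (Some k)) v != arhs k -> tgt S' v = tgt S v.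
Proof. by move=> kv; rewrite /tgt /S' ractU1 tightU1_neq. Qed.

Lemma basic_step v : ev (r (Some k)) v < arhs k -> bas S v -> bas S' v.
Proof.
move=> kv [fv sv]; split; last by rewrite -/(tgt S' v) tight_step// lt_eqF.
by rewrite /S' ractU1; apply/feasibleU1; split=> //; exact: ltW.
Qed.

Lemma basic_unstep v : ev (r (Some k)) v != arhs k -> bas S' v -> bas S v.
Proof.
move=> kv [fv sv]; split; last by move: sv; rewrite -/(tgt S' v) tight_step.
by move: fv; rewrite /S' ractU1 => /feasibleU1[].
Qed.

(** Every vertex of a climb after the first has positive height, so [kept] applies to it; only the
    start needs a hypothesis. *)
Lemma path_step v p : bas S v -> ev (r (Some k)) v < arhs k ->
    path (fun v1 v2 => `[< climb a S v1 v2 >]) v p ->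
  path (fun v1 v2 => `[< climb a S' v1 v2 >]) v p.
Proof.
elim: p v => //= u p IH v bv kv /andP[/asboolP[[_ bu cvu] vu] pu].
have zu : 0 < zcoord u by apply: le_lt_trans vu; exact: feasible_z bv.1.
have ku := kept bu zu; apply/andP; split; last exact: IH.
apply/asboolP; split=> //; split; [exact: basic_step|exact: basic_step|].
by rewrite -/(tgt S' v) -/(tgt S' u) !tight_step ?lt_eqF.
Qed.

(* A new non-base vertex cuts the unique non-base edge of a removed base vertex. *)
Lemma new_nonbase w : bas S' w -> ev (r (Some k)) w = arhs k -> 0 < zcoord w ->
  [/\ #|tgt S' w| = (d + 1)%N, l1norm (w - apex) < e &
      exists2 p, path (fun v1 v2 => `[< climb a S' v1 v2 >]) w p /\ last w p = apex
               & (size p <= #|S| - d)%N].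
Proof.
move=> bw kw zw; pose T := tgt S w.
have tw : tgt S' w = Some k |: T by rewrite /tgt /S' ractU1 tightU1.
have fw : feasible r rrhs (ract S) w.
  by have := bw.1; rewrite /S' ractU1 => /feasibleU1[].
have spT : spanning r (Some k |: T) by rewrite -tw; exact: bw.2.
have kT : Some k \notin T by rewrite inE Some_ract (negPf kS).
(* Otherwise [w] would be an old non-base vertex, hence strictly inside row [k]. *)
have nspT : ~ spanning r T.
  by move=> sp; have := kept (conj fw sp) zw; rewrite kw ltxx.
have [g [gT gk]] : exists g, (forall i, i \in T -> ev (r i) g = 0) /\ 0 < ev (r (Some k)) g.
  have [g g0 gT] := not_spanning nspT.
  case: (ltrgt0P (ev (r (Some k)) g)) => gk; first by exists g.
    by exists (- g); rewrite evNr oppr_gt0; split=> // i iT; rewrite evNr gT ?oppr0.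
  suff g00 : g = 0 by rewrite g00 eqxx in g0.
  by apply: spT => i; rewrite finset.in_setU1 => /orP[/eqP ->//|]; exact: gT.
have g0 : g != 0 by apply/eqP => g00; rewrite g00 ev0r ltxx in gk.
have [i0 i0S gi0] := recession_trivial IS a_gt0 g0.
have [t [[t0 bu Tu] _]] :=
  ray_to_basic fw (fintype.subxx T) spT gT (lt0r_neq0 gk) i0S gi0.
set u := w + t *: g in bu Tu.
(* Row [k] increases along [g], so it is not strictly satisfied at [u]; by [kept] this happens only
   in the base. *)
have zu : zcoord u = 0.
  apply/le_anti; rewrite (feasible_z bu.1) andbT leNgt; apply/negP => /(kept bu).
  by rewrite evDr evZr kw gtrDl pmulr_llt0// ltNge t0.
have t_gt0 : 0 < t.
  rewrite lt_neqAle t0 andbT eq_sym; apply/eqP => t00.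
  by move: zu; rewrite /u t00 scale0r addr0 => zw0; rewrite zw0 ltxx in zw.
have ku : arhs k < ev (r (Some k)) u by rewrite evDr evZr kw ltrDl mulr_gt0.
have NT : None \notin T by rewrite None_tight gt_eqF.
have Nu : None \in tgt S u by rewrite None_tight zu.
have cuN : #|tgt S u :\ None| = d.
  by apply: card_setD1_succ => //; exact: card_tgt.
have TuN : T = tgt S u :\ None.
  apply/eqP; rewrite eqEcard cuN finset.subsetD1 NT andbT; apply/andP; split=> //.
  by have := spanning_card spT; rewrite cardsU1 kT addn1 add1n ltnS.
(* The climb from [u] is nonempty, because [u] has height 0 and the apex height 1; its first edge
   turns out to contain [w]. *)
have [[|v p] [up lp] sp] : exists2 p, path (fun v1 v2 => `[< climb a S v1 v2 >]) u p
    /\ last u p = apex & (size p <= #|S| - d)%N by case: good => _ _ _ _; apply.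
  by move: zu; move: lp => /= ->; rewrite zcoord_pt => /eqP; rewrite oner_eq0.
move: up => /= /andP[/asboolP[[_ bv cuv] zuv] vp].
have zv : 0 < zcoord v by rewrite -zu.
have kv := kept bv zv.
have Nv : None \notin tgt S v by rewrite None_tight gt_eqF.
(* [u] and [v] share [d] tight inequalities and [None] is not among them, so they share exactly
   [T]. *)
have Tv : T \subset tgt S v.
  suff -> : T = tgt S u :&: tgt S v by exact: finset.subsetIr.
  apply/esym/eqP; rewrite TuN eqEcard cuN; apply/andP; split; last first.
    by rewrite -ltnS [X in (_ < X)%N](etrans cuv (addn1 d)).
  by rewrite finset.subsetD1 finset.subsetIl finset.in_setI (negPf Nv) andbF.
have onT v1 : T \subset tgt S v1 -> forall i, i \in T -> ev (r i) v1 = ev (r i) w.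
  move=> /fintype.subsetP Tx i iT; have [_ ->] := tightP _ _ _ _ _ iT.
  by have [_ ->] := tightP _ _ _ _ _ (Tx i iT).
have kuv : ev (r (Some k)) (v - u) < 0 by rewrite evBr subr_lt0; exact: lt_trans ku.
(* [u], [v] and [w] lie on the line fixed by [T]; row [k] exceeds its bound at [u] and stays below
   it at [v], so [w] is strictly between them. *)
have [s sE wE] : exists2 s, s = (arhs k - ev (r (Some k)) u) / ev (r (Some k)) (v - u)
    & w - u = s *: (v - u).
  eexists; first by reflexivity.
  rewrite -kw -evBr; apply: (kernel_line spT) => [i iT|i iT|]; last by rewrite lt_eqF.
    by rewrite evBr !onT ?subrr.
  by rewrite evBr !onT ?subrr.
have s_gt0 : 0 < s by rewrite sE ltr_ndivlMr ?mul0r ?subr_lt0.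
have s_lt1 : s < 1 by rewrite sE ltr_ndivrMr// mul1r evBr ltrD2r.
have {}wE : w = (1 - s) *: u + s *: v.
  by rewrite -[LHS](subrK u) wE scalerBl scalerBr scale1r addrC addrA addrAC.
pose x := usubmx u; have uE : u = pt x 0 by rewrite [LHS]pt_eta zu.
have spx : spanning arow (tight arow arhs S x).
  by apply: (@spanning_base a); rewrite -uE; exact: bu.2.
have kx : arhs k < ev (arow k) x.
  by move: ku; rewrite uE ev_Some mulr0 addr0.
have nv : l1norm (v - apex) < e' by case: good => _ _ _ h _; exact: h.
split.
- by rewrite tw cardsU1 kT TuN cuN addnC.
- by rewrite wE uE; apply: near_apex => //; rewrite -?uE -?wE// !ltW.
(* [w] takes the place of [u] at the start of the climb, so the length is unchanged. *)
exists (v :: p) => //; split=> //=; apply/andP; split; last exact: path_step.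
apply/asboolP; split.
  split=> //; first exact: basic_step.
  rewrite -/(tgt S' w) -/(tgt S' v) (tight_step (v := v)) ?lt_eqF// tw.
  have -> : (Some k |: T) :&: tgt S v = T.
    rewrite finset.setIUl (finset.setIidPl Tv); apply/finset.setUidPr.
    apply/fintype.subsetP => j; rewrite finset.in_setI finset.in_set1 => /andP[/eqP ->].
    by rewrite inE Some_ract (negPf kS).
  by rewrite TuN cuN addn1.
by rewrite wE zcoordD !zcoordZ zu mulr0 add0r gtr_pMl.
Qed.

(** Relaxing [None] alone gives a rising edge; row [k] stays tight along it, so [new_nonbase]
    applies to its upper end. *)
Lemma new_base w : bas S' w -> ev (r (Some k)) w = arhs k -> zcoord w = 0 ->
  exists2 p, path (fun v1 v2 => `[< climb a S' v1 v2 >]) w p /\ last w p = apex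
           & (size p <= #|S'| - d)%N.
Proof.
move=> bw kw zw.
have cw : #|tgt S' w| = (d + 1)%N.
  by move: bw; rewrite (pt_eta w) zw; exact: card_tight_base.
have Nw : None \in tgt S' w by rewrite None_tight zw.
pose T := tgt S' w :\ None.
have cT : #|T| = d by exact: card_setD1_succ.
have NT : None |: T = tgt S' w by rewrite finset.setD1K.
have spT : spanning r (None |: T) by rewrite NT; exact: bw.2.
have [g [gT gN]] : exists g, (forall i, i \in T -> ev (r i) g = 0) /\ 0 < zcoord g.
  have nspT : ~ spanning r T by move=> /spanning_card; rewrite cT addn1 ltnn.
  have [g g0 gT] := not_spanning nspT.
  case: (ltrgt0P (zcoord g)) => gk; first by exists g.
    exists (- g); rewrite -scaleN1r zcoordZ mulN1r oppr_gt0; split=> // i iT.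
    by rewrite evZr gT ?mulr0.
  suff g00 : g = 0 by rewrite g00 eqxx in g0.
  apply: spT => i; rewrite finset.in_setU1 => /orP[/eqP ->|]; last exact: gT.
  by rewrite ev_None gk oppr0.
have g0 : g != 0.
  by apply/eqP => g00; rewrite g00 -pt0 zcoord_pt ltxx in gN.
have gN' : ev (r None) g != 0 by rewrite ev_None oppr_eq0 gt_eqF.
have [i0 i0S gi0] := recession_trivial IS' a_gt0 g0.
have [t [[t0 bw' Tw'] [j jw' gj]]] :=
  ray_to_basic bw.1 (finset.subD1set _ _) spT gT gN' i0S gi0.
set w' := w + t *: g in bw' Tw' jw'.
(* If [t] were 0, the blocking inequality [j] would be tight at [w], but the rows in [T] are
   constant along [g] and [None] decreases. *)
have t_gt0 : 0 < t.
  rewrite lt_neqAle t0 andbT eq_sym; apply/eqP => t00.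
  move: jw'; rewrite /w' t00 scale0r addr0 -/(tgt S' w) -NT finset.in_setU1.
  case/orP => [/eqP jN|/gT gj0]; last by rewrite gj0 ltxx in gj.
  by move: gj; rewrite jN ev_None; lra.
have zw' : 0 < zcoord w' by rewrite zcoordD zcoordZ zw add0r mulr_gt0.
have kw' : ev (r (Some k)) w' = arhs k.
  suff /(fintype.subsetP Tw')/tightP[_] : Some k \in T by [].
  by rewrite finset.in_setD1 /=; apply/tightP; rewrite Some_ract setU11.
have [cw' _ [p [pp lp] sp]] := new_nonbase bw' kw' zw'.
exists (w' :: p); last first.
  (* The inclusion of [I0] in [S] gives [d < #|S|], so the truncated subtraction really grows by
     one. *)
  by have := subset_leq_card IS; rewrite I0_card /= /S' cardsU1 kS add1n => dS; rewrite subSn// ltnW.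
split=> //=; rewrite pp andbT; apply/asboolP; split; last by rewrite zw.
split=> //; suff -> : tight r rrhs (ract S') w :&: tight r rrhs (ract S') w' = T.
  by rewrite cT addn1.
apply/eqP; rewrite finset.eqEsubset finset.subsetI Tw' finset.subD1set !andbT.
rewrite finset.subsetD1 finset.subsetIl finset.in_setI.
have /negPf -> : None \notin tgt S' w' by rewrite None_tight gt_eqF.
by rewrite andbF.
Qed.

Lemma rock_good_step : rock_good S' a e.
Proof.
have kapex : ev (r (Some k)) apex < arhs k.
  by apply: kept; [case: good|rewrite zcoord_pt].
have zS v : bas S' v -> 0 <= zcoord v by move=> [fv _]; exact: feasible_z fv.
split.
- split=> // i; rewrite /S' finset.in_setU1 => /orP[/eqP ->//|]; by case: good => -[_ +] *; auto.
- by apply: basic_step => //; case: good.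
- move=> v bv; case: (eqVneq (ev (r (Some k)) v) (arhs k)) => kv; last first.
    by rewrite -/(tgt S' v) tight_step//; apply: card_tgt; exact: basic_unstep.
  have := zS v bv; rewrite le_eqVlt => /orP[/eqP zv|zv].
    by move: bv; rewrite (pt_eta v) -zv; exact: card_tight_base.
  by have [] := new_nonbase bv kv zv.
- move=> v bv zv; case: (eqVneq (ev (r (Some k)) v) (arhs k)) => kv.
    by have [] := new_nonbase bv kv zv.
  by apply: lt_le_trans ee'; case: good => _ _ _ h _; apply: h => //; exact: basic_unstep.
- have leS : (#|S| - d <= #|S'| - d)%N by rewrite leq_sub2r// subset_leq_card// finset.subsetUr.
  move=> v bv; case: (eqVneq (ev (r (Some k)) v) (arhs k)) => kv; last first.
    have bSv := basic_unstep kv bv.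
    have kv' : ev (r (Some k)) v < arhs k.
      rewrite lt_neqAle kv /=; move: bv.1; rewrite /S' ractU1 => /feasibleU1[]; exact.
    have [p [pp lp] sp] : exists2 p, path (fun v1 v2 => `[< climb a S v1 v2 >]) v p
      /\ last v p = apex & (size p <= #|S| - d)%N by case: good => _ _ _ _; apply.
    by exists p; [split=> //; exact: path_step|exact: leq_trans leS].
  have := zS v bv; rewrite le_eqVlt => /orP[/eqP zv|zv]; first exact: new_base.
  have [_ _ [p pp sp]] := new_nonbase bv kv zv.
  by exists p => //; exact: leq_trans leS.
Qed.

End Step.

(** [a0] prescribes the tilts outside [S]; through it the tilt [s] of row [k] enters the recursion
    before the remaining tilts are chosen. *)
Lemma rock_good_exists S : I0 \subset S -> forall e a0, 0 < e ->
  exists a, (forall i, i \notin S -> a i = a0 i) /\ rock_good S a e.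
Proof.
have [n] := ubnP #|S :\: I0|; elim: n S => // n IH S; rewrite ltnS => cS IS e a0 e0.
have [SI|/finset.set0Pn[k]] := eqVneq (S :\: I0) finset.set0.
  have -> : S = I0.
    by apply/eqP; rewrite finset.eqEsubset IS andbT -finset.setD_eq0 SI.
  exists (fun i => if i \in I0 then arhs i - ev (arow i) o else a0 i); split.
    by move=> i /negPf ->.
  by apply: rock_good_simplex => // i ->.
rewrite finset.in_setD => /andP[kI kS].
have SE : S = k |: S :\ k by rewrite finset.setD1K.
have IS' : I0 \subset S :\ k by rewrite finset.subsetD1 IS.
have cS' : (#|S :\ k :\: I0| < n)%N.
  apply: leq_trans cS; rewrite [X in (_ < X)%N](cardsD1 k) finset.in_setD kI kS add1n ltnS.
  apply: subset_leq_card; apply/fintype.subsetP => i; rewrite !inE.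
  by case/and3P => -> -> ->.
have [s [e' [s0 [e'0 ee'] miss near_apex]]] := tilt_exists (S :\ k) k e0.
have [a [aE good]] := IH _ cS' IS' e' (fun i => if i == k then s else a0 i) e'0.
have ak : a k = s by rewrite aE ?eqxx// !inE eqxx.
exists a; split.
  move=> i iS; rewrite aE; last by rewrite !inE (negPf iS) andbF.
  by case: eqVneq iS => // ->; rewrite kS.
rewrite SE; apply: (rock_good_step (e' := e')) => //.
- by rewrite !inE eqxx.
- by rewrite ak.
- by move=> v; rewrite /= ak; exact: miss.
- by move=> x v t; rewrite /= ak; exact: near_apex.
Qed.

End RockSystem.

(** * The starting simplex and the rock extension *)

Lemma bounded_l1norm (R : realType) n (F : set 'cV[R]_n) (B : R) :
  (forall x, F x -> l1norm x <= B) -> bounded_set F.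
Proof.
move=> FB; exists B; split; first exact: num_real.
move=> M BM x Fx /=; apply: le_trans (ltW BM); apply: le_trans (FB x Fx).
rewrite [leLHS]mx_normrE; apply: bigmax_le => [|[i j] _]; first exact: l1norm_ge0.
by rewrite (ord1 j); exact: l1norm_coord.
Qed.

Lemma polyhedron_feasible (R : realType) n (I : finType) (r : I -> 'rV[R]_n) (c : I -> R) :
  feasible r c [set: I]%SET =
  polyhedron (row_matrix r [set: I]%SET) (\col_j c (enum_val j)).
Proof.
have rE w j : (row_matrix r [set: I]%SET *m w) j 0 = ev (r (enum_val j)) w.
  by rewrite /ev !mxE; apply: eq_bigr => l _; rewrite !mxE.
apply/seteqP; split=> w wP.
  by move=> j; rewrite rE mxE; apply: wP; rewrite inE.
move=> i _; have iT : i \in [set: I]%SET by rewrite inE.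
by have := wP (enum_rank_in iT i); rewrite rE mxE enum_rankK_in.
Qed.

Section Simplex.
Variables (R : realType) (d : nat) (I : finType) (r : I -> 'rV[R]_d) (c : I -> R).
Variables (J : {set I}) (o : 'cV[R]_d).
Hypothesis J_simplex : is_simplex d [set x | forall i, i \in J -> ev (r i) x <= c i].
Hypothesis J_card : #|J| = d.+1.
Hypothesis o_in : forall i, i \in J -> ev (r i) o <= c i.

Lemma simplex_bounded : exists B, forall x,
  (forall i, i \in J -> ev (r i) x <= c i) -> l1norm x <= B.
Proof.
case: J_simplex => p [_ pE]; exists (\sum_i l1norm (p i)) => x xJ.
have [t [t0 t1 ->]] : conv_hull p x by rewrite -pE.
apply: le_trans (l1norm_sum _) _; apply: ler_sum => i _.
rewrite l1normZ ger0_norm// ler_piMl ?l1norm_ge0//.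
by rewrite -t1 (bigD1 i)//= lerDl sumr_ge0.
Qed.

(** Otherwise the ray from [o] in direction [y] would stay in the bounded simplex. *)
Lemma simplex_recession y : (forall i, i \in J -> ev (r i) y <= 0) -> y = 0.
Proof.
move=> yJ; apply/l1norm_eq0/eqP; apply: contrapT => /negP y0.
have y_gt0 : 0 < l1norm y by rewrite lt_neqAle eq_sym y0 l1norm_ge0.
have [B BJ] := simplex_bounded.
have oB := BJ _ o_in; have o0 := l1norm_ge0 o.
(* The displacement then has norm [B + l1norm o + 1], more than the triangle inequality allows
   inside the simplex. *)
pose t := (B + l1norm o + 1) / l1norm y.
have t0 : 0 <= t by rewrite divr_ge0 ?l1norm_ge0//; lra.
have : l1norm (o + t *: y) <= B.
  apply: BJ => i iJ; rewrite evDr evZr; apply: le_trans (o_in iJ).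
  by rewrite gerDl mulr_ge0_le0// yJ.
have : l1norm (t *: y) <= l1norm (o + t *: y) + l1norm (- 1 *: o).
  by apply: le_trans (l1normD _ _); rewrite scaleN1r addrAC subrr add0r.
rewrite !l1normZ normrN normr1 mul1r ger0_norm// /t divfK ?gt_eqF//; lra.
Qed.

Lemma simplex_spanning : spanning r J.
Proof. by move=> g gJ; apply: simplex_recession => i /gJ ->. Qed.

(* The d + 1 outer normals of a simplex have a strictly positive linear
   dependency: the column space of the row matrix is the orthogonal complement of
   a vector u and contains no nonzero nonpositive vector. *)
Lemma simplex_dependency : exists2 lam : I -> R,
  forall i, i \in J -> 0 < lam i & \sum_(i in J) lam i *: r i = 0.
Proof.
pose M := row_matrix r J.
have rM : \rank M = d := spanning_rank simplex_spanning.
(* [M] has [d + 1] rows and rank [d], so its left kernel is nonzero. *)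
have [u u0 uM] : exists2 u : 'rV[R]_#|J|, u != 0 & u *m M = 0.
  exists (nz_row (kermx M)).
    by rewrite nz_row_eq0 kermx_eq0 /row_free rM J_card neq_ltn ltnSn.
  by apply/sub_kermxP; exact: nz_row_sub.
(* By rank, the image of [M] is the whole orthogonal complement of [u]; a nonpositive vector in it
   comes from a recession direction of the simplex. *)
have imM (y : 'cV[R]_#|J|) : u *m y = 0 -> (forall j, y j 0 <= 0) -> y = 0.
  move=> uy y0.
  have : (kermx u^T <= M^T)%MS.
    have le1 : (M^T <= kermx u^T)%MS by apply/sub_kermxP; rewrite -trmx_mul uM trmx0.
    rewrite -(mxrank_leqif_sup le1) mxrank_tr rM mxrank_ker mxrank_tr rank_rV u0 J_card.
    by rewrite subn1.
  have yk : (y^T <= kermx u^T)%MS by apply/sub_kermxP; rewrite -trmx_mul uy trmx0.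
  move/(submx_trans yk)/submxP => [D yD].
  have {yD} yE : y = M *m D^T by apply: trmx_inj; rewrite trmx_mul trmxK.
  have -> : y = 0; last by [].
  rewrite yE (_ : D^T = 0) ?mulmx0//; apply: simplex_recession => i iJ.
  have := y0 (enum_rank_in iJ i); rewrite yE /M; congr (_ <= _).
  rewrite /ev !mxE; apply: eq_bigr => l _; rewrite !mxE enum_rankK_in//.
(* If an entry of [u] vanished, minus a unit vector would be nonpositive and orthogonal to [u]. *)
have un0 j : u 0 j != 0.
  apply/eqP => uj; have : (- delta_mx j 0 : 'cV[R]_#|J|) = 0.
    apply: imM => [|l]; last by rewrite !mxE oppr_le0 ler0n.
    by rewrite mulmxN -colE; apply/matrixP => i l; rewrite !ord1 !mxE uj oppr0.
  by move/matrixP/(_ j 0); rewrite !mxE !eqxx => /eqP; rewrite oppr_eq0 oner_eq0.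
have same_sign j l : 0 < u 0 j -> 0 < u 0 l.
  move=> uj; rewrite lt_neqAle eq_sym un0 leNgt; apply/negP => ul.
  have jl : j != l by apply: contraTneq uj => ->; rewrite -leNgt ltW.
  (* With [u 0 l < 0 < u 0 j], both nonzero entries of [y] are negative. *)
  pose y : 'cV[R]_#|J| := u 0 l *: delta_mx j 0 - u 0 j *: delta_mx l 0.
  have uy : u *m y = 0.
    rewrite mulmxBr -!scalemxAr -!colE; apply/matrixP => i i'; rewrite !ord1 !mxE; ring.
  have y0 i : y i 0 <= 0.
    rewrite !mxE eqxx !andbT; case: eqP => [->|_]; case: eqP => [|_]; rewrite ?mulr1 ?mulr0; lra.
  have /matrixP/(_ j 0) := imM y uy y0; rewrite !mxE !eqxx (negPf jl) mulr1 mulr0 subr0.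
  by apply/eqP; exact: un0.
have [s sP] : exists s, forall j, 0 < s * u 0 j.
  case: (pselect (exists j, 0 < u 0 j)) => [[j uj]|nu].
    by exists 1 => l; rewrite mul1r; exact: same_sign uj.
  exists (-1) => j; rewrite mulN1r oppr_gt0 lt_neqAle un0 leNgt.
  by apply/negP => uj; apply: nu; exists j.
have [i0 i0J] : exists i, i \in J by apply/finset.set0Pn; rewrite -cards_eq0 J_card.
exists (fun i => s * u 0 (enum_rank_in i0J i)) => [i _|]; first exact: sP.
rewrite big_enum_val /=.
under eq_bigr do rewrite enum_valK_in -scalerA.
transitivity (s *: (u *m M)); last by rewrite uM scaler0.
by rewrite -scaler_sumr mulmx_sum_row; under [in RHS]eq_bigr do rewrite rowK.
Qed.

End Simplex.

(** A small shift of [o] along the normal stays in the ball and raises [ev A] strictly. *)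
Lemma slack_of_ball (R : realType) n (A : 'M[R]_(1, n)) (e : R) (o : 'cV[R]_n) (c : R) :
  0 < e -> A != 0 -> (forall x, eball e o x -> ev A x <= c) -> ev A o < c.
Proof.
move=> e0 A0 ballc; pose t := e / 2 / (1 + l1norm A^T).
have N0 : 0 < 1 + l1norm A^T by rewrite ltr_pwDl// l1norm_ge0.
have t0 : 0 < t by rewrite !divr_gt0.
have : ev A (o + t *: A^T) <= c.
  apply: ballc; apply: eball_l1norm; rewrite addrAC subrr add0r l1normZ gtr0_norm//.
  rewrite /t mulrAC ltr_pdivrMr//; have := l1norm_ge0 A^T; nra.
apply: lt_le_trans; rewrite evDr evZr ltrDl mulr_gt0//.
rewrite evE lt_neqAle eq_sym; apply/andP; split; last first.
  by apply: sumr_ge0 => j _; rewrite mxE -expr2 sqr_ge0.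
apply: contraNneq A0 => s0; apply/eqP/matrixP => i j; rewrite ord1 mxE.
have : A 0 j * A^T j 0 = 0.
  by apply: (psumr_eq0P _ s0) => // l _; rewrite mxE -expr2 sqr_ge0.
by rewrite mxE => /eqP; rewrite mulf_eq0 orbb => /eqP.
Qed.

(** * From the invariant to the polytope *)

Section RockPolytope.
Variables (R : realType) (m d : nat) (A : 'M[R]_(m, d)) (b : 'cV[R]_m).
Variables (o : 'cV[R]_d) (I0 : {set 'I_m}) (a : 'I_m -> R) (e : R).
Let r := rrow A a.
Let c := rrhs b.
Let Q : set 'cV[R]_(d + 1) := feasible r c [set: option 'I_m]%SET.
Let bas := basic r c [set: option 'I_m]%SET.
Let tgt := tight r c [set: option 'I_m]%SET.
Hypothesis good : rock_good A b o I0 [set: 'I_m]%SET a e.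

Let a_gt0 : forall i, 0 < a i.
Proof. by move=> i; case: good => -[_ +] *; apply; rewrite inE. Qed.

Let bas_apex : bas (pt o 1).
Proof. by case: good => _; rewrite ract_setT. Qed.

Let card_tgt : forall v, bas v -> #|tgt v| = (d + 1)%N.
Proof. by case: good => _ _; rewrite ract_setT. Qed.

Lemma rock_setE : Q = [set w | exists (x : 'cV[R]_d) (z : R),
  [/\ w = pt x z, forall i, (A *m x + z *: (\col_i a i)) i 0 <= b i 0 & 0 <= z]].
Proof.
have zE i x z : (A *m x + z *: (\col_i a i)) i 0 = ev (r (Some i)) (pt x z).
  by rewrite ev_Some ev_arow !mxE mulrC.
apply/seteqP; split=> [w Qw|_ [x [z [-> xz z0]]]].
  exists (usubmx w), (zcoord w); split; first exact: pt_eta.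
    by move=> i; rewrite zE -pt_eta; apply: Qw; rewrite inE.
  by have := Qw None; rewrite inE ev_None oppr_le0; apply.
move=> [i|] _; first by rewrite -zE; exact: xz.
by rewrite ev_None zcoord_pt oppr_le0.
Qed.

(** As the tilts are positive and heights nonnegative, dropping the height only relaxes the
    inequalities. *)
Lemma rock_base_feasible w : Q w ->
  0 <= zcoord w /\ forall i, ev (arow A i) (usubmx w) <= arhs b i.
Proof.
move=> Qw; have z0 : 0 <= zcoord w.
  by have := Qw None; rewrite inE ev_None oppr_le0; apply.
split=> // i; have := Qw (Some i); rewrite inE {1}(pt_eta w) ev_Some => /(_ isT).
by apply: le_trans; rewrite lerDl mulr_ge0// ltW.
Qed.

Lemma rock_polytope B : (forall w, Q w -> zcoord w <= 1) ->
  (forall x, (forall i, ev (arow A i) x <= arhs b i) -> l1norm x <= B) -> polytope Q.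
Proof.
move=> z1 PB; split.
  by exists _, (row_matrix r [set: option 'I_m]%SET), (\col_j c (enum_val j));
    exact: polyhedron_feasible.
apply: (@bounded_l1norm _ _ _ (B + 1)) => w Qw; have [z0 xP] := rock_base_feasible Qw.
by rewrite [X in l1norm X](pt_eta w) l1norm_pt lerD ?PB// ger0_norm ?z1.
Qed.

Lemma rock_simple : polytope Q -> simple_polytope (d + 1) Q.
Proof.
move=> polQ; split=> //; first exact: (has_dim_feasible bas_apex (card_tgt bas_apex)).
by move=> v /vertex_basic bv; apply: card_facets => //; exact: card_tgt.
Qed.

Lemma climb_to_apex v : vertex Q v -> exists2 p,
  path (fun v1 v2 => `[< climb A b a [set: 'I_m]%SET v1 v2 >]) v p /\ last v p = pt o 1
  & (size p <= m - d)%N.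
Proof.
move/vertex_basic; rewrite -ract_setT => bv.
by case: good => _ _ _ _ /(_ v bv); rewrite cardsT card_ord.
Qed.

Lemma rock_path v : vertex Q v -> exists2 p,
  z_increasing_path Q v (pt o 1) p & (size p <= m - d)%N.
Proof.
move=> /climb_to_apex [p [vp lp] sp]; exists p => //; split=> //.
  apply: sub_path vp => v1 v2 /asboolP[nv v12]; apply/asboolP.
  rewrite /climb ract_setT in nv.
  apply: neighbours_adjacent => //; first by apply: card_tgt; case: nv.
  by move=> v12E; rewrite v12E ltxx in v12.
by apply: sub_path vp => v1 v2 /asboolP[].
Qed.

Lemma rock_concentrated (P : set 'cV[R]_d) : P = polyhedron A b ->
    (forall w, Q w -> zcoord w <= 1) -> eball e o `<=` P ->
  concentrated P Q e o 1.
Proof.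
move=> PE z1 ballP; split=> // [v|v vv nb].
  have apexV : vertex Q (pt o 1) by exact/vertex_basic.
  split=> [[vv vmax]|->]; last first.
    by split=> // w /vertex_basic [Qw _]; rewrite zcoord_pt; exact: z1.
  (* A vertex other than the apex starts a climb, so it lies strictly below height 1 and is not a
     top vertex. *)
  have [[|w p] [vp //= lp] _] := climb_to_apex vv.
  move: vp => /= /andP[/asboolP[[_ bw _] vw] _].
  have [Qw _] : bas w by move: bw; rewrite ract_setT.
  have := lt_le_trans vw (z1 _ Qw); rewrite ltNge.
  by have := vmax _ apexV; rewrite zcoord_pt => ->.
move/vertex_basic: vv => bv; have [z0 xP] := rock_base_feasible bv.1.
apply: eball_l1norm; case: good => _ _ _ + _; apply; first by rewrite ract_setT.
rewrite lt_neqAle z0 andbT eq_sym; apply/eqP => zv; apply: nb.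
exists (usubmx v); last by rewrite [RHS]pt_eta zv.
by rewrite PE => i; rewrite -ev_arow.
Qed.

End RockPolytope.

Unset Implicit Arguments.

Theorem theorem2p7 (R : realType) (m d : nat)
    (A : 'M[R]_(m, d)) (b : 'cV[R]_m) (P : set 'cV[R]_d)
    (P_def : P = polyhedron A b)
    (P_polytope : polytope P)
    (P_dim : has_dim P d)
    (Ab_nondegenerate : nondegenerate_system A b)
    (Ab_simplex : simplex_containing A b)
    (eps : R) (eps_gt0 : 0 < eps)
    (o : 'cV[R]_d) (ball_in_P : eball eps o `<=` P) :
  exists Q : set 'cV[R]_(d + 1),
    [/\ rock_extension A b Q,
        simple_polytope (d + 1) Q,
        concentrated P Q eps o 1 &
        forall v, vertex Q v ->
          exists2 p : seq 'cV[R]_(d + 1),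
            z_increasing_path Q v (pt o 1) p & (size p <= m - d)%N].
Proof.
have nd := nondegenerate_systemP Ab_nondegenerate.
have o_int i : ev (arow A i) o < arhs b i.
  apply: (slack_of_ball eps_gt0); first by case: Ab_nondegenerate => + _ _; apply.
  by move=> x /ball_in_P; rewrite P_def ev_arow; apply.
have [I0 [I0_card I0_simplex]] := Ab_simplex.
have {}I0_simplex : is_simplex d [set x | forall i, i \in I0 -> ev (arow A i) x <= arhs b i].
  move: I0_simplex; congr is_simplex; apply/seteqP.
  by split=> x /= xI i /xI; rewrite ev_arow.
have o_in i : i \in I0 -> ev (arow A i) o <= arhs b i by move=> _; exact: ltW.
have [B PB] := simplex_bounded I0_simplex.
have I0_spanning := simplex_spanning I0_simplex o_in.
have [lam lam_gt0 lam_dep] := simplex_dependency I0_simplex I0_card o_in.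
have I0T := finset.subsetT I0.
(* No row lies outside the full index set, so the prescribed tilts [fun=> 1] are a dummy value. *)
have [a [_ good]] := rock_good_exists nd o_int lam_gt0 lam_dep I0_spanning I0_card I0T
  (fun=> 1) eps_gt0.
pose Q := feasible (rrow A a) (rrhs b) [set: option 'I_m]%SET.
have z1 w : Q w -> zcoord w <= 1.
  rewrite /Q -ract_setT; apply: (feasible_z_le1 o_int lam_gt0 lam_dep I0_card I0T).
  by case: good => -[].
have polQ : polytope Q.
  by apply: (rock_polytope good z1 (B := B)) => x xP; apply: PB => i _.
exists Q; split.
- split=> //; exists (\col_i a i); split; last exact: rock_setE.
  by move=> i; rewrite mxE; case: good => -[_ +] *; apply; rewrite inE.
- exact: rock_simple good polQ.
- exact: rock_concentrated good _ P_def z1 ball_in_P.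
- by move=> v; exact: rock_path good v.
Qed.
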